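(* Let $H$ be a compact subgroup of $\mathbb{T}$ (that is, $H=\mathbb{T}$ or $H=H_r$ for some $r\in\mathbb{N}$), let $a\in\mathbb{T}$, $b\in[0,\infty)$, and let $\eta$ be a Lévy measure on $\mathbb{T}$. Let $U$, $X$, $Y$ be independent real random variables such that: - $U$ is uniformly distributed on $[0,2\pi]$ if $H=\mathbb{T}$, and $U$ is uniformly distributed on $\{2\pi j/r: j=0,1,\dots,r-1\}$ if $H=H_r$; - $X$ has a normal distribution on $\mathbb{R}$ with zero mean and variance $b$; - the distribution of $Y$ is the generalized Poisson measure $\pi_{\arg\circ\eta,\,g_{\mathbb{R}}}$ on $\mathbb{R}$, where the measure $\arg\circ\eta$ on $\mathbb{R}$ is defined by $(\arg\circ\eta)(B):=\eta(\{x\in\mathbb{T}:\arg(x)\in B\})$ for all Borel subsets $B$ of $\mathbb{R}$. Then the $\mathbb{T}$-valued random element $\mathrm{e}^{i(U+\arg a+X+Y)}$ has distribution $$\omega_H*\delta_a*\gamma_{\psi_b}*\pi_{\eta,\,g_{\mathbb{T}}}.$$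
   Context: $\mathbb{N}$ is the set of positive integers. $\mathbb{T}=\{\mathrm{e}^{ix}:-\pi\le x<\pi\}$ is the group of complex numbers of modulus one under multiplication, with its usual topology. For $r\in\mathbb{N}$, $H_r:=\{\mathrm{e}^{2\pi ij/r}:j=0,1,\dots,r-1\}$; the compact subgroups of $\mathbb{T}$ are the $H_r$ and $\mathbb{T}$ itself. The function $\arg:\mathbb{T}\to[-\pi,\pi)$ is $\arg(\mathrm{e}^{ix}):=x$ for $-\pi\le x<\pi$. The function $h:\mathbb{R}\to\mathbb{R}$ is defined by $h(x)=0$ if $x<-\pi$ or $x\ge\pi$; $h(x)=-x-\pi$ if $-\pi\le x<-\pi/2$; $h(x)=x$ if $-\pi/2\le x<\pi/2$; $h(x)=-x+\pi$ if $\pi/2\le x<\pi$. General notions. Let $G$ be a locally compact Abelian $T_0$-topological group with a countable basis of its topology and with identity $e$. Measures on $G$ are Borel measures. $\widehat{G}$ is the group of characters (continuous homomorphisms $\chi:G\to\mathbb{T}$), and $\widehat{\mu}(\chi)=\int_G\chi\,\mathrm{d}\mu$ for a bounded measure $\mu$; a probability measure on $G$ is determined by $\widehat{\mu}$. A Lévy measure on $G$ is a measure $\eta$ with values in $[0,+\infty]$ such that $\eta(\{e\})=0$, $\eta(G\setminus U)<\infty$ for every Borel neighbourhood $U$ of $e$, and $\int_G(1-\mathrm{Re}\,\chi(x))\,\mathrm{d}\eta(x)<\infty$ for all $\chi\in\widehat{G}$. For a Lévy measure $\eta$ and a local inner product $g:G\times\widehat{G}\to\mathbb{R}$ (only the specific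 functions given below are needed), the generalized Poisson measure $\pi_{\eta,g}$ is the probability measure on $G$ with $\widehat{\pi}_{\eta,g}(\chi)=\exp\{\int_G(\chi(x)-1-ig(x,\chi))\,\mathrm{d}\eta(x)\}$ for all $\chi\in\widehat{G}$. $\delta_a$ is the Dirac measure at $a$, $\omega_H$ is the Haar measure of the compact subgroup $H$ normalized by $\omega_H(H)=1$ and regarded as a measure on $G$, and $*$ is convolution. For $G=\mathbb{T}$: $\widehat{\mathbb{T}}=\{\chi_\ell:\ell\in\mathbb{Z}\}$ with $\chi_\ell(y)=y^\ell$; $g_{\mathbb{T}}(y,\chi_\ell):=\ell\,h(\arg y)$; for $b\ge0$, $\psi_b(\chi_\ell):=b\ell^2$, and $\gamma_{\psi_b}$ is the (symmetric Gauss) probability measure on $\mathbb{T}$ with $\widehat{\gamma}_{\psi_b}(\chi_\ell)=\mathrm{e}^{-b\ell^2/2}$ for all $\ell\in\mathbb{Z}$. For $G=\mathbb{R}$: $\widehat{\mathbb{R}}=\{\chi_y:y\in\mathbb{R}\}$ with $\chi_y(x)=\mathrm{e}^{iyx}$, and $g_{\mathbb{R}}(x,\chi_y):=y\,h(x)$. The normal distribution with mean zero and variance $0$ is $\delta_0$. *)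

(* Defs.v *)
From HB Require Import structures.
From mathcomp Require Import all_boot all_order all_algebra.
From mathcomp Require Import all_classical all_reals all_analysis.
From mathcomp Require Import measurable_realfun.
From mathcomp Require Import complex.

Set Implicit Arguments.
Unset Strict Implicit.
Unset Printing Implicit Defensive.

Import Order.TTheory GRing.Theory Num.Theory.
Import numFieldNormedType.Exports.

Local Open Scope classical_set_scope.
Local Open Scope ring_scope.
Local Open Scope complex_scope.

(* The group of complex numbers of modulus one, written multiplicatively in
   group_scope. *)
Record circle (R : realType) := Circle {
  cval :> R[i];
  cvalP : Normc.normc cval == 1 }.

HB.instance Definition _ (R : realType) := [isSub for @cval R].
HB.instance Definition _ (R : realType) := [Choice of circle R by <:].

Section circle_group.
Context {R : realType}.
Implicit Types z w : circle R.

Fact circle_one_subproof : Normc.normc (1 : R[i]) == 1.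
Proof. by rewrite Normc.normc1. Qed.

Fact circle_mul_subproof z w : Normc.normc ((z : R[i]) * (w : R[i])) == 1.
Proof. by rewrite Normc.normcM (eqP (cvalP z)) (eqP (cvalP w)) mulr1. Qed.

Fact circle_inv_subproof z : Normc.normc (z : R[i])^-1 == 1.
Proof. by rewrite Normc.normcV (eqP (cvalP z)) invr1. Qed.

Definition circle_one : circle R := Circle circle_one_subproof.
Definition circle_mul z w : circle R := Circle (circle_mul_subproof z w).
Definition circle_inv z : circle R := Circle (circle_inv_subproof z).

Fact circle_neq0 z : (z : R[i]) != 0.
Proof.
apply/eqP => z0; have := cvalP z.
by rewrite z0 Normc.normc0 eq_sym oner_eq0.
Qed.

Fact circle_mulA : associative circle_mul.
Proof. by move=> x y z; apply/val_inj; rewrite /= mulrA. Qed.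

Fact circle_mul1 : left_id circle_one circle_mul.
Proof. by move=> x; apply/val_inj; rewrite /= mul1r. Qed.

Fact circle_mulr1 : right_id circle_one circle_mul.
Proof. by move=> x; apply/val_inj; rewrite /= mulr1. Qed.

Fact circle_mulV : left_inverse circle_one circle_inv circle_mul.
Proof. by move=> x; apply/val_inj; rewrite /= mulVf // circle_neq0. Qed.

Fact circle_mulrV : right_inverse circle_one circle_inv circle_mul.
Proof. by move=> x; apply/val_inj; rewrite /= mulfV // circle_neq0. Qed.

End circle_group.

HB.instance Definition _ (R : realType) := isGroup.Build (circle R)
  circle_mulA circle_mul1 circle_mulr1 circle_mulV circle_mulrV.
HB.instance Definition _ (R : realType) :=
  isPointed.Build (circle R) (@circle_one R).

(* Subspace topology of the plane R^2. *)
HB.instance Definition _ (R : realType) := Topological.copy (circle R)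
  (initial_topology (fun z : circle R => (complex.Re z, complex.Im z))).

HB.instance Definition _ (R : realType) :=
  Measurable.copy (circle R) (g_sigma_algebraType (@open (circle R))).

Section circle_theory.
Context {R : realType}.
Implicit Types (x y : R) (z w : circle R).

Fact expi_subproof x : Normc.normc (cos x +i* sin x) == 1.
Proof. by rewrite /= cos2Dsin2 sqrtr1. Qed.

(* e^{ix} *)
Definition expi x : circle R := Circle (expi_subproof x).

(* The branch with values in [-pi, pi); at z = -1 the else-branch gives
   - acos (-1) = - pi. *)
Definition arg z : R := if 0 < complex.Im z then acos (complex.Re z) else - acos (complex.Re z).

Lemma expiD x y : expi (x + y) = (expi x * expi y)%g.
Proof.
apply/val_inj; rewrite /= cosD sinD.
by apply/eqP; rewrite eq_complex /= eqxx /= addrC eqxx.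
Qed.

Lemma circle_sqr z : complex.Re z ^+ 2 + complex.Im z ^+ 2 = 1.
Proof.
have := cvalP z; case: (cval z) => a b /= /eqP h.
have : Num.sqrt (a ^+ 2 + b ^+ 2) ^+ 2 = 1 by rewrite h expr1n.
by rewrite sqr_sqrtr // addr_ge0 // sqr_ge0.
Qed.

Lemma circle_Re_itv z : -1 <= complex.Re z <= 1.
Proof.
by rewrite -ler_norml -(@expr_le1 _ 2) // real_normK ?num_real // -(circle_sqr z) lerDl sqr_ge0.
Qed.

Lemma argK : cancel arg expi.
Proof.
move=> z; apply/val_inj; rewrite /= /arg.
have zB := circle_Re_itv z.
have h : 1 - complex.Re z ^+ 2 = complex.Im z ^+ 2 by rewrite -(circle_sqr z) addrAC subrr add0r.
have zI : complex.Re z \in `[-1, 1] by rewrite in_itv.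
case: ifPn => [I0|].
  rewrite acosK // sin_acos // h sqrtr_sqr gtr0_norm //.
  by case: (cval z).
rewrite -leNgt => I0.
rewrite cosN sinN acosK // sin_acos // h sqrtr_sqr ler0_norm // opprK.
by case: (cval z).
Qed.

Lemma expiK x : - pi <= x < pi -> arg (expi x) = x.
Proof.
move=> /andP[x1 x2]; rewrite /arg /=.
have [x0|x0] := ltP 0 x.
  by rewrite sin_gt0_pi ?x0 // cosK // in_itv /= !ltW.
have -> : (0 < sin x) = false.
  apply/negbTE; rewrite -leNgt -[x]opprK sinN oppr_le0 sin_ge0_pi //.
  by rewrite oppr_ge0 x0 /= lerNl.
by rewrite cosKN ?x1 ?opprK.
Qed.

Lemma expi_continuous : continuous expi.
Proof.
apply/continuousP => _ [B oB <-].
rewrite (_ : expi @^-1` _ = (fun x => (cos x, sin x)) @^-1` B) //.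
have /continuousP : continuous (fun x : R => (cos x, sin x)).
  by move=> x; exact: (cvg_pair (@continuous_cos R x) (@continuous_sin R x)).
exact.
Qed.

Lemma expi_measurable : measurable_fun setT expi.
Proof.
have := @measurability _ _ _ _ setT expi (@open (circle R)) erefl; apply.
move=> _ [A oA <-]; rewrite setTI; apply: open_measurable.
by move/continuousP : expi_continuous; apply.
Qed.

HB.instance Definition _ :=
  isMeasurableFun.Build _ _ R (circle R) expi expi_measurable.

Lemma circle_continuous_measurable (f : circle R -> R) :
  continuous f -> measurable_fun setT f.
Proof.
move=> /continuousP cf; apply: (measurability _ (RGenOpens.measurableE R)).
move=> _ [_ [a [b ->] <-]]; rewrite setTI.
by apply: sub_sigma_algebra; apply: cf; exact: interval_open.
Qed.

Lemma circle_Re_continuous : continuous (fun z : circle R => complex.Re z).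
Proof.
move=> z; apply: (@continuous_comp _ _ _
  (fun z : circle R => (complex.Re z, complex.Im z)) fst); last exact: cvg_fst.
exact: initial_continuous.
Qed.

Lemma circle_Im_continuous : continuous (fun z : circle R => complex.Im z).
Proof.
move=> z; apply: (@continuous_comp _ _ _
  (fun z : circle R => (complex.Re z, complex.Im z)) snd); last exact: cvg_snd.
exact: initial_continuous.
Qed.

Lemma acos_Re_measurable : measurable_fun setT (fun z : circle R => acos (complex.Re z)).
Proof.
apply: (measurability _ (RGenInftyO.measurableE R)).
move=> _ [_ [t ->] <-]; rewrite setTI.
have mRe := circle_continuous_measurable circle_Re_continuous.
rewrite [X in measurable X](_ : _ = if t <= 0 then set0 else
  if pi < t then setT else (fun z : circle R => complex.Re z) @^-1` `]cos t, +oo[).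
  case: ifP => // _; case: ifP => // _.
  by rewrite -[X in measurable X]setTI; exact: mRe.
have zB z := circle_Re_itv z.
have aI z : acos (complex.Re z) \in `[0, pi].
  by rewrite in_itv /= acos_ge0 ?acos_lepi.
case: ifPn => [t0|]; last rewrite -ltNge => t0.
  rewrite -subset0 => z /=; rewrite in_itv /= => /lt_le_trans/(_ t0).
  by rewrite ltNge acos_ge0.
case: ifPn => [tpi|]; last rewrite -leNgt => tpi.
  rewrite -subTset => z _ /=; rewrite in_itv /=.
  by rewrite (le_lt_trans _ tpi) // acos_lepi.
have acos_lt z : (acos (complex.Re z) < t) = (cos t < complex.Re z).
  have tI : t \in `[0, pi] by rewrite in_itv /= ltW.
  have zI : complex.Re z \in `[-1, 1] by rewrite in_itv /= zB.
  by rewrite -(ltr_cos (aI z) tI) acosK.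
by apply/seteqP; split => z /=; rewrite !in_itv /= andbT acos_lt.
Qed.

Lemma arg_measurable : measurable_fun setT arg.
Proof.
have mIm := circle_continuous_measurable circle_Im_continuous.
apply: measurable_fun_ifT.
- exact: measurable_fun_ltr.
- exact: acos_Re_measurable.
- exact: measurableT_comp acos_Re_measurable.
Qed.

HB.instance Definition _ :=
  isMeasurableFun.Build _ _ (circle R) R arg arg_measurable.

Lemma circle_mul_measurable :
  measurable_fun setT (fun p : circle R * circle R => (p.1 * p.2)%g).
Proof.
rewrite (_ : (fun p => _) = expi \o (fun p : circle R * circle R =>
    arg p.1 + arg p.2)); last first.
  by apply/funext => p /=; rewrite expiD !argK.
apply: measurableT_comp; first exact: expi_measurable.
by apply: measurable_funD; apply: measurableT_comp => //; exact: arg_measurable.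
Qed.

End circle_theory.

Section convolution.
Context {R : realType}.
Local Open Scope ereal_scope.

Definition convolution (mu nu : probability (circle R) R) :
    set (circle R) -> \bar R :=
  fun A => (mu \x nu) [set p | A (p.1 * p.2)%g].

Variables mu nu : probability (circle R) R.

Let pre_measurable (A : set (circle R)) : measurable A ->
  measurable [set p : circle R * circle R | A (p.1 * p.2)%g].
Proof.
move=> mA; rewrite -[X in measurable X]setTI.
exact: (circle_mul_measurable measurableT mA).
Qed.

Let convolution0 : convolution mu nu set0 = 0.
Proof. exact: measure0. Qed.

Let convolution_ge0 A : 0 <= convolution mu nu A.
Proof. exact: measure_ge0. Qed.

Let convolution_sigma_additive : semi_sigma_additive (convolution mu nu).
Proof.
move=> F mF tF mUF; rewrite /convolution.
rewrite (_ : [set p | _] =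
    \bigcup_i [set p : circle R * circle R | F i (p.1 * p.2)%g]); last by [].
apply: measure_semi_sigma_additive.
- by move=> i; exact: pre_measurable.
- apply/trivIsetP => i j _ _ ij; apply/seteqP; split => // p [Fi Fj].
  move/trivIsetP : tF => /(_ _ _ I I ij); rewrite -subset0; apply.
  by split; [exact: Fi|exact: Fj].
- rewrite (_ : \bigcup_i _ =
    [set p | (\bigcup_i F i) (p.1 * p.2)%g]); last by [].
  exact: pre_measurable.
Qed.

HB.instance Definition _ := isMeasure.Build _ _ _ (convolution mu nu)
  convolution0 convolution_ge0 convolution_sigma_additive.

Let convolutionT : convolution mu nu setT = 1.
Proof. exact: probability_setT. Qed.

HB.instance Definition _ := Measure_isProbability.Build _ _ _
  (convolution mu nu) convolutionT.

End convolution.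

Section arg_image.
Context {R : realType}.
Variable eta : {measure set (circle R) -> \bar R}.

Definition arg_image : set R -> \bar R := fun B => eta [set z | B (arg z)].

Let arg_image0 : arg_image set0 = 0%E.
Proof. exact: measure0. Qed.

Let arg_image_ge0 B : (0 <= arg_image B)%E.
Proof. exact: measure_ge0. Qed.

Let arg_image_sigma_additive : semi_sigma_additive arg_image.
Proof.
exact: (@measure_semi_sigma_additive _ _ _ (pushforward eta arg)).
Qed.

HB.instance Definition _ := isMeasure.Build _ _ _ arg_image
  arg_image0 arg_image_ge0 arg_image_sigma_additive.

End arg_image.

Definition expc {R : realType} (z : R[i]) : R[i] :=
  (expR (complex.Re z))%:C * (expi (complex.Im z) : R[i]).

Definition cintegral d (T : measurableType d) (R : realType)
    (mu : {measure set T -> \bar R}) (f : T -> R[i]) : R[i] :=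
  (\int[mu]_x complex.Re (f x)) +i* (\int[mu]_x complex.Im (f x)).

Section laws.
Context {R : realType}.

Definition h_saw (x : R) : R :=
  if (x < - pi) || (pi <= x) then 0
  else if x < - (pi / 2) then - x - pi
  else if x < pi / 2 then x
  else - x + pi.

(* The characters chi_l (l : int) of the circle and chi_y (y : R) of the real
   line, as complex-valued functions. *)
Definition chiT (l : int) (z : circle R) : R[i] := (z : R[i]) ^ l.
Definition chiR (y x : R) : R[i] := expi (y * x).

Definition gT (z : circle R) (l : int) : R := l%:~R * h_saw (arg z).
Definition gR (x y : R) : R := y * h_saw x.

(* The dual group of G is given as the family chi, indexed by I.  A probability
   measure is determined by its Fourier transform, so at most one mu satisfies
   this up to equality on measurable sets; likewise for gauss_circle. *)
Definition generalized_poisson d (G : measurableType d) (I : Type)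
    (chi : I -> G -> R[i]) (g : G -> I -> R)
    (eta : {measure set G -> \bar R}) (mu : probability G R) : Prop :=
  forall i : I, cintegral mu (chi i) =
    expc (cintegral eta (fun x => chi i x - 1 - (g x i)*i)).

Definition levy_measure (eta : {measure set (circle R) -> \bar R}) : Prop :=
  [/\ eta [set 1%g] = 0%E,
      forall U : set (circle R), measurable U -> nbhs (1%g : circle R) U ->
        (eta (~` U) < +oo)%E &
      forall l : int,
        (\int[eta]_z (1 - complex.Re (chiT l z))%:E < +oo)%E].

Definition psi (b : R) (l : int) : R := b * l%:~R ^+ 2.

Definition gauss_circle (b : R) (gamma : probability (circle R) R) : Prop :=
  forall l : int, cintegral gamma (chiT l) = (expR (- psi b l / 2))%:C.

Definition compact_subgroup (H : set (circle R)) : Prop :=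
  [/\ compact H, H 1%g, forall z w, H z -> H w -> H (z * w)%g &
      forall z, H z -> H (z^-1)%g].

Definition roots_of_unity (r : nat) : set (circle R) :=
  [set expi (2 * pi * j%:R / r%:R) | j in [set j | (j < r)%N]].

(* omega is the normalized Haar measure of H, extended by 0 to the circle. *)
Definition haar (H : set (circle R)) (omega : probability (circle R) R) :
    Prop :=
  omega H = 1%E /\
  forall (w : circle R) (A : set (circle R)), H w -> measurable A ->
    A `<=` H -> omega [set z | A (w * z)%g] = omega A.

Fact two_pi_gt0 : 0 < 2 * pi :> R.
Proof. by rewrite mulr_gt0 ?pi_gt0. Qed.

Definition uniform_grid (r : nat) (B : set R) : \bar R :=
  (\sum_(j < r) (r%:R^-1)%:E * \d_(2 * pi * j%:R / r%:R)%R B)%E.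

(* Normal distribution with mean 0 and variance b; normal_prob takes the
   standard deviation and is not the Dirac measure when the latter is 0. *)
Definition centered_normal (b : R) (B : set R) : \bar R :=
  if b == 0 then \d_(0 : R) B else normal_prob 0 (Num.sqrt b) B.

End laws.

(* Taking some of the sets to be setT gives the product rule for pairs. *)
Definition independent3 d (Omega : measurableType d) (R : realType)
    (P : probability Omega R) (U X Y : {RV P >-> R}) : Prop :=
  forall A B C : set R, measurable A -> measurable B -> measurable C ->
    (P (U @^-1` A `&` X @^-1` B `&` Y @^-1` C) =
     P (U @^-1` A) * P (X @^-1` B) * P (Y @^-1` C))%E.

(* Main.v *)
(* The law of e^{i(U + arg a + X + Y)} is the convolution of the laws of e^{iU},
   the point mass at a, and the laws of e^{iX} and e^{iY}, by independence, so the
   factors can be identified one at a time.  A probability measure on the circle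
   is determined by its Fourier coefficients, and the l-th coefficient of the law
   of e^{iZ} is the characteristic function of Z at the integer l.  For Y the two
   exponents agree because g_T(z, chi_l) = g_R(arg z, chi_l); for X this is the
   characteristic function of the normal law; for U on the whole circle all
   coefficients with l <> 0 vanish on both sides, and for U on the r-th roots of
   unity both measures give each root the mass 1/r.

   Uniqueness of Fourier coefficients: call m a multiplier if multiplication by m
   preserves the bounded functions f for which f * chi_l has the same integral
   against both measures for every l.  Multipliers form an algebra closed under
   bounded pointwise limits, containing Re z and Im z; hence the sets whose
   indicator is a multiplier form a sigma-algebra containing every open set. *)

From HB Require Import structures.
Require Import Defs.
From mathcomp Require Import all_boot all_order all_algebra.
From mathcomp Require Import all_classical all_reals all_analysis.
From mathcomp Require Import measurable_realfun complex.
From mathcomp Require Import ring lra.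

Set Implicit Arguments.
Unset Strict Implicit.
Unset Printing Implicit Defensive.

Import Order.TTheory GRing.Theory Num.Theory.
Import numFieldNormedType.Exports.

Local Open Scope classical_set_scope.
Local Open Scope ring_scope.

(** * Uniqueness of Fourier coefficients on the circle *)

Section characters.
Context {R : realType}.

Lemma expi0 : expi 0 = 1%g :> circle R.
Proof. by apply/val_inj; rewrite /= cos0 sin0. Qed.

Lemma expiN (x : R) : expi (- x) = (expi x)^-1%g.
Proof. by apply/esym/mulg1_eq; rewrite -expiD subrr expi0. Qed.

Lemma chiT_expi (l : int) (x : R) :
  chiT l (expi x) = expi (l%:~R * x) :> R[i].
Proof.
have chiT_nat (n : nat) : (expi x : R[i]) ^+ n = expi (n%:R * x).
  elim: n => [|n IHn]; first by rewrite expr0 mul0r expi0.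
  by rewrite exprS IHn -natr1 mulrDl mul1r addrC expiD.
case: l => n; first exact: chiT_nat.
rewrite NegzE /chiT -[LHS]/((expi x : R[i]) ^+ n.+1)^-1 chiT_nat.
by rewrite mulrNz mulNr expiN.
Qed.

Lemma chiT_arg (l : int) (z : circle R) :
  chiT l z = expi (l%:~R * arg z) :> R[i].
Proof. by rewrite -{1}(argK z) chiT_expi. Qed.

End characters.

(** * Polynomials tending on [0, 1] to the indicator of u < 1/2 *)

Section threshold.
Context {R : realType}.
Implicit Types (u x : R) (n : nat).

Lemma bernoulli_ineq x n : -1 <= x -> 1 + n%:R * x <= (1 + x) ^+ n.
Proof.
move=> x1; elim: n => [|n IHn]; first by rewrite mul0r addr0 expr0.
rewrite exprS; apply: (@le_trans _ _ ((1 + x) * (1 + n%:R * x))); last first.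
  by apply: ler_wpM2l => //; rewrite -lerBlDl sub0r.
have : 0 <= n%:R * x ^+ 2 by rewrite mulr_ge0 // sqr_ge0.
by rewrite -natr1; nra.
Qed.

(* The first factor tends to 1 on [0, 1/2[ and to 0 on ]1/2, 1]; the second one
   tends to 1 off 1/2 and kills the value at 1/2. *)
Definition threshold n u : R :=
  (1 - u ^+ n) ^+ (2 ^ n) * (1 - (1 - (u - 1 / 2) ^+ 2) ^+ n).

Lemma threshold_bound n u : 0 <= u <= 1 -> `|threshold n u| <= 1.
Proof.
move=> u01.
have p01 x m : 0 <= x <= 1 -> 0 <= x ^+ m <= 1.
  by case/andP => x0 x1; rewrite exprn_ge0 // exprn_ile1.
have q01 x : 0 <= x <= 1 -> 0 <= 1 - x <= 1 by lra.
have h1 : 0 <= 1 - (u - 1 / 2) ^+ 2 <= 1.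
  have /andP[u0 u1] := u01; have := sqr_ge0 (u - 1 / 2); rewrite expr2; nra.
have /andP[a0 a1] := p01 _ (2 ^ n)%N (q01 _ (p01 _ n u01)).
have /andP[b0 b1] := q01 _ (p01 _ n h1).
by rewrite /threshold ger0_norm ?mulr_ge0 // mulr_ile1.
Qed.

(** Since 2^n u^n = (2u)^n, Bernoulli's inequality keeps the first factor above 1 - (2u)^n when u <
    1/2. When u > 1/2 it gives (1 + u^n)^(2^n) >= (2u)^n, and (1 - u^n)(1 + u^n) <= 1 then forces
    the first factor below (2u)^(-n). *)
Lemma threshold_cvg u : 0 <= u <= 1 ->
  threshold n u @[n --> \oo] --> ((u < 1 / 2)%R%:R : R).
Proof.
move=> /andP[u0 u1]; rewrite /threshold.
have [->|uneq] := eqVneq u (1 / 2).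
  rewrite ltxx subrr expr0n /= subr0.
  under eq_fun do rewrite expr1n subrr mulr0.
  exact: cvg_cst.
have v01 : 0 <= 1 - (u - 1 / 2) ^+ 2 < 1.
  have : 0 < (u - 1 / 2) ^+ 2 by rewrite exprn_even_gt0 //= subr_eq0.
  by rewrite expr2; nra.
have snd1 : (1 - (1 - (u - 1 / 2) ^+ 2) ^+ n) @[n --> \oo] --> (1 : R).
  rewrite -[X in _ --> X]subr0; apply: cvgB; first exact: cvg_cst.
  by apply: cvg_expr; rewrite ger0_norm; case/andP: v01.
rewrite -[X in _ --> X]mulr1; apply: cvgM => //.
have pow2 n : ((2 ^ n)%N)%:R * u ^+ n = (2 * u) ^+ n :> R.
  by rewrite natrX exprMn.
have un01 n : 0 <= u ^+ n <= 1 by rewrite exprn_ge0 // exprn_ile1.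
have [ul|ug] := ltP u (1 / 2).
  apply: (@squeeze_cvgr _ _ _ _ (fun n => 1 - (2 * u) ^+ n) (cst 1)).
  - apply: nearW => n; apply/andP; split.
      have := @bernoulli_ineq (- u ^+ n) (2 ^ n); rewrite mulrN pow2; apply.
      by have := un01 n; lra.
    by apply: exprn_ile1; have := un01 n; lra.
  - rewrite -[X in _ --> X]subr0; apply: cvgB; first exact: cvg_cst.
    by apply: cvg_expr; rewrite ger0_norm; lra.
  - exact: cvg_cst.
have {uneq} ug2 : 1 / 2 < u by rewrite lt_neqAle eq_sym uneq.
apply: (@squeeze_cvgr _ _ _ _ (cst 0) (fun n => (2 * u)^-1 ^+ n)).
- apply: nearW => n; apply/andP; split.
    by apply: exprn_ge0; have := un01 n; lra.
  have tu0 : 0 < (2 * u) ^+ n by apply: exprn_gt0; lra.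
  rewrite exprVn -[leRHS]mul1r ler_pdivlMr //.
  have le1 : (1 - u ^+ n) ^+ (2 ^ n) * (1 + u ^+ n) ^+ (2 ^ n) <= 1.
    by rewrite -exprMn; apply: exprn_ile1; have := un01 n; nra.
  apply: le_trans le1; apply: ler_wpM2l.
    by apply: exprn_ge0; have := un01 n; lra.
  have := @bernoulli_ineq (u ^+ n) (2 ^ n); rewrite pow2.
  by have := un01 n; lra.
- exact: cvg_cst.
- apply: cvg_expr; rewrite ger0_norm ?invr_ge0; last by lra.
  by rewrite invf_lt1; lra.
Qed.

End threshold.

(** * Bounded measurable functions under a probability measure *)

Section bounded_measurable.
Context d (T : measurableType d) (R : realType).
Implicit Types f g : T -> R.

Definition bounded_measurable f :=
  measurable_fun setT f /\ exists K, forall z, `|f z| <= K.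

Lemma bounded_measurable_cst (r : R) : bounded_measurable (cst r).
Proof. by split=> //; exists `|r|. Qed.

Lemma bounded_measurableD f g : bounded_measurable f ->
  bounded_measurable g -> bounded_measurable (fun z => f z + g z).
Proof.
move=> [mf [K fK]] [mg [L gL]]; split; first exact: measurable_funD.
by exists (K + L) => z; rewrite (le_trans (ler_normD _ _)) // lerD.
Qed.

Lemma bounded_measurableM f g : bounded_measurable f ->
  bounded_measurable g -> bounded_measurable (fun z => f z * g z).
Proof.
move=> [mf [K fK]] [mg [L gL]]; split; first exact: measurable_funM.
by exists (K * L) => z; rewrite normrM ler_pM.
Qed.

Lemma bounded_measurable_integrable (mu : probability T R) f :
  bounded_measurable f -> mu.-integrable setT (EFin \o f).
Proof.
move=> [mf [K fK]]; apply: measurable_bounded_integrable => //.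
  by rewrite (le_lt_trans (probability_le1 _ _)) // ltry.
exists K; split; first exact: num_real.
by move=> M KM z _; apply: (le_trans (fK z)); exact: ltW.
Qed.

Lemma bounded_cvg_Rintegral (mu : probability T R) (f_ : nat -> T -> R) f (K : R) :
    (forall n, measurable_fun setT (f_ n)) ->
    (forall n z, `|f_ n z| <= K) ->
    (forall z, f_ n z @[n --> \oo] --> f z) ->
  \int[mu]_z f_ n z @[n --> \oo] --> \int[mu]_z f z.
Proof.
move=> mf_ fK fcvg.
have mf : measurable_fun setT f.
  by apply: (measurable_fun_cvg mf_) => z _; exact: fcvg.
have [|||||intf _ ic] := @dominated_convergence _ _ _ mu setT measurableT
    (fun n => EFin \o f_ n) (EFin \o f) (cst K%:E).
- by move=> n; exact/measurable_EFinP.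
- exact/measurable_EFinP.
- by apply: aeW => z _; apply: cvg_EFin; [exact: nearW|exact: fcvg].
- exact: (bounded_measurable_integrable _ (bounded_measurable_cst K)).
- by apply: aeW => z n _; rewrite lee_fin; exact: fK.
by apply: fine_cvg; rewrite fineK //; exact: integrable_fin_num intf.
Qed.

End bounded_measurable.

Lemma bounded_Rintegral_linear d (T : measurableType d) (R : realType)
    (mu : probability T R) (p q : R) (f g : T -> R) :
    bounded_measurable f -> bounded_measurable g ->
  \int[mu]_z (p * f z + q * g z) = p * \int[mu]_z f z + q * \int[mu]_z g z.
Proof.
move=> bf bg; have bZ r k := bounded_measurableM (bounded_measurable_cst T r) k.
rewrite RintegralD // ?RintegralZl //; apply: bounded_measurable_integrable=> //;
  exact: bZ.
Qed.

(** * Multipliers and the sigma-algebra of determined sets *)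

Section fourier_uniqueness.
Context {R : realType}.
Variables mu nu : probability (circle R) R.
Hypothesis mu_nu : forall l, cintegral mu (chiT l) = cintegral nu (chiT l).
Implicit Types f m : circle R -> R.

(** Real part of chi_l, with [s] the imaginary part, written through [arg] so that the addition
    formulas apply. *)
Let c (l : int) (z : circle R) : R := cos (l%:~R * arg z).
Let s (l : int) (z : circle R) : R := sin (l%:~R * arg z).

(** All l are required at once because multiplication by [c 1] or [s 1] shifts the index l by one in
    both directions. *)
Let equi f := bounded_measurable f /\ forall l,
  \int[mu]_z (f z * c l z) = \int[nu]_z (f z * c l z) /\
  \int[mu]_z (f z * s l z) = \int[nu]_z (f z * s l z).

(** Stability of [equi] under multiplication by m, rather than membership of m in [equi], makes
    closure under products immediate. *)
Let multiplier m := bounded_measurable m /\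
  forall f, equi f -> equi (fun z => m z * f z).

Let bm_c l : bounded_measurable (c l).
Proof.
split; last by exists 1 => z; rewrite ler_norml cos_geN1 cos_le1.
apply: measurableT_comp; first by
  apply: continuous_measurable_fun; exact: continuous_cos.
by apply: measurable_funM => //; exact: arg_measurable.
Qed.

Let bm_s l : bounded_measurable (s l).
Proof.
split; last by exists 1 => z; rewrite ler_norml sin_geN1 sin_le1.
apply: measurableT_comp; first by
  apply: continuous_measurable_fun; exact: continuous_sin.
by apply: measurable_funM => //; exact: arg_measurable.
Qed.

Let equi1 : equi (cst 1).
Proof.
split=> [|l]; first exact: bounded_measurable_cst.
have := mu_nu l; rewrite /cintegral => -[re im].
have cE z : c l z = complex.Re (chiT l z) by rewrite chiT_arg.
have sE z : s l z = complex.Im (chiT l z) by rewrite chiT_arg.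
by split; under eq_Rintegral do [rewrite mul1r ?cE ?sE];
  under [RHS]eq_Rintegral do [rewrite mul1r ?cE ?sE].
Qed.

Let equiZ (r : R) f : equi f -> equi (fun z => r * f z).
Proof.
move=> [bf ef]; split=> [|l].
  exact: (bounded_measurableM (bounded_measurable_cst _ r) bf).
have [ec es] := ef l.
by split; under eq_Rintegral do rewrite -mulrA;
  under [RHS]eq_Rintegral do rewrite -mulrA;
  rewrite !RintegralZl ?ec ?es //; apply: bounded_measurable_integrable;
  apply: bounded_measurableM.
Qed.

Let equiD f g : equi f -> equi g -> equi (fun z => f z + g z).
Proof.
move=> [bf ef] [bg eg]; split=> [|l]; first exact: bounded_measurableD.
have [ec es] := ef l; have [ec' es'] := eg l.
by split; under eq_Rintegral do rewrite mulrDl;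
  under [RHS]eq_Rintegral do rewrite mulrDl;
  rewrite !RintegralD ?ec ?es ?ec' ?es' //;
  apply: bounded_measurable_integrable; apply: bounded_measurableM.
Qed.

Let multiplier_cst (r : R) : multiplier (cst r).
Proof. by split=> [|f]; [exact: bounded_measurable_cst|exact: equiZ]. Qed.

Let multiplierD m1 m2 : multiplier m1 -> multiplier m2 ->
  multiplier (fun z => m1 z + m2 z).
Proof.
move=> [b1 e1] [b2 e2]; split=> [|f ef]; first exact: bounded_measurableD.
by under eq_fun do rewrite mulrDl; apply: equiD; [exact: e1|exact: e2].
Qed.

Let multiplierM m1 m2 : multiplier m1 -> multiplier m2 ->
  multiplier (fun z => m1 z * m2 z).
Proof.
move=> [b1 e1] [b2 e2]; split=> [|f ef]; first exact: bounded_measurableM.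
by under eq_fun do rewrite -mulrA; exact/e1/e2.
Qed.

Let multiplierB m1 m2 : multiplier m1 -> multiplier m2 ->
  multiplier (fun z => m1 z - m2 z).
Proof.
move=> M1 M2; under eq_fun do rewrite -mulN1r.
apply: multiplierD => //; apply: multiplierM => //.
exact: (multiplier_cst (-1)).
Qed.

Let multiplierX m n : multiplier m -> multiplier (fun z => m z ^+ n).
Proof.
move=> M; elim: n => [|n IHn]; first exact: (multiplier_cst 1).
by under eq_fun do rewrite exprS; exact: multiplierM.
Qed.

(** Under each measure the integrals converge by bounded convergence; the two sequences of integrals
    coincide, hence so do their limits. *)
Let multiplier_lim (m_ : nat -> circle R -> R) m (K : R) :
    (forall n, multiplier (m_ n)) -> (forall n z, `|m_ n z| <= K) ->
    (forall z, m_ n z @[n --> \oo] --> m z) ->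
  multiplier m.
Proof.
move=> M_ mK mcvg.
have bm : bounded_measurable m.
  split; first by apply: (measurable_fun_cvg (fun n => (M_ n).1.1)) => z _.
  exists K => z; apply: (cvgr_to_le (cvg_norm (mcvg z))).
  by apply: nearW => n; exact: mK.
split=> // f ef; split; first by apply: bounded_measurableM => //; exact: ef.1.
have lim_eq g : bounded_measurable g ->
    (forall n, \int[mu]_z (m_ n z * f z * g z) =
               \int[nu]_z (m_ n z * f z * g z)) ->
    \int[mu]_z (m z * f z * g z) = \int[nu]_z (m z * f z * g z).
  move=> bg eq_n.
  have [mfg [L fgL]] : bounded_measurable (fun z => f z * g z).
    by apply: bounded_measurableM => //; exact: ef.1.
  have icvg (rho : probability (circle R) R) :
      \int[rho]_z (m_ n z * f z * g z) @[n --> \oo] -->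
      \int[rho]_z (m z * f z * g z).
    apply: (@bounded_cvg_Rintegral _ _ _ _ _ _ (K * L)) => [n|n z|z].
    - under eq_fun do rewrite -mulrA.
      by apply: measurable_funM => //; exact: (M_ n).1.1.
    - by rewrite -mulrA normrM ler_pM.
    - by apply: cvgM; [apply: cvgM => //; exact: cvg_cst|exact: cvg_cst].
  have := icvg mu; rewrite (eq_cvg _ _ eq_n) => mu_cvg.
  exact: (cvg_unique (@Rhausdorff R) mu_cvg (icvg nu)).
move=> l; have H n := ((M_ n).2 _ ef).2 l.
by split; apply: lim_eq => // n; have [] := H n.
Qed.

(** Meant for the product-to-sum formulas, which write m c_l and m s_l through cosines and sines of
    index l + 1 and l - 1. The families are kept separate because cosine and sine exchange roles
    when m is [s 1]. *)
Let multiplier_trig m p q p' q' (a b a' b' : int -> circle R -> R) :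
    bounded_measurable m ->
    (forall l, bounded_measurable (a l)) -> (forall l, bounded_measurable (b l)) ->
    (forall l, bounded_measurable (a' l)) -> (forall l, bounded_measurable (b' l)) ->
    (forall l z, m z * c l z = p * a l z + q * b l z) ->
    (forall l z, m z * s l z = p' * a' l z + q' * b' l z) ->
    (forall f l, equi f -> \int[mu]_z (f z * a l z) = \int[nu]_z (f z * a l z)) ->
    (forall f l, equi f -> \int[mu]_z (f z * b l z) = \int[nu]_z (f z * b l z)) ->
    (forall f l, equi f -> \int[mu]_z (f z * a' l z) = \int[nu]_z (f z * a' l z)) ->
    (forall f l, equi f -> \int[mu]_z (f z * b' l z) = \int[nu]_z (f z * b' l z)) ->
  multiplier m.
Proof.
move=> bm ba bb ba' bb' mc ms ea eb ea' eb'; split=> // f ef.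
have bf := ef.1; split=> [|l]; first exact: bounded_measurableM.
have cE z : m z * f z * c l z = p * (f z * a l z) + q * (f z * b l z).
  by rewrite mulrAC mc; ring.
have sE z : m z * f z * s l z = p' * (f z * a' l z) + q' * (f z * b' l z).
  by rewrite mulrAC ms; ring.
by split; under eq_Rintegral do rewrite ?cE ?sE;
  under [RHS]eq_Rintegral do rewrite ?cE ?sE;
  rewrite !bounded_Rintegral_linear ?ea ?eb ?ea' ?eb' //;
  exact: bounded_measurableM.
Qed.

Let multiplier_c1 : multiplier (c 1).
Proof.
apply: (@multiplier_trig _ 2^-1 2^-1 2^-1 2^-1
  (fun l => c (l + 1)) (fun l => c (l - 1))
  (fun l => s (l + 1)) (fun l => s (l - 1))) => //.
- by move=> l z; rewrite /c !rmorphD !mulrDl rmorphN !mulNr cosB cosD; field.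
- by move=> l z; rewrite /c /s !rmorphD !mulrDl rmorphN !mulNr sinB sinD; field.
- by move=> f l [_ /(_ (l + 1))[]].
- by move=> f l [_ /(_ (l - 1))[]].
- by move=> f l [_ /(_ (l + 1))[]].
- by move=> f l [_ /(_ (l - 1))[]].
Qed.

Let multiplier_s1 : multiplier (s 1).
Proof.
apply: (@multiplier_trig _ 2^-1 (- 2^-1) 2^-1 (- 2^-1)
  (fun l => s (l + 1)) (fun l => s (l - 1))
  (fun l => c (l - 1)) (fun l => c (l + 1))) => //.
- by move=> l z; rewrite /c /s !rmorphD !mulrDl rmorphN !mulNr sinB sinD; field.
- by move=> l z; rewrite /c /s !rmorphD !mulrDl rmorphN !mulNr cosB cosD; field.
- by move=> f l [_ /(_ (l + 1))[]].
- by move=> f l [_ /(_ (l - 1))[]].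
- by move=> f l [_ /(_ (l - 1))[]].
- by move=> f l [_ /(_ (l + 1))[]].
Qed.

Let determined (A : set (circle R)) := multiplier (\1_A).

(** An affine change of scale turns m < t into u < 1/2 with u in [0, 1]. [threshold n u] is a
    polynomial in u, hence a multiplier, and its pointwise limit is the indicator. *)
Let determined_lt m t : multiplier m -> determined [set z | m z < t].
Proof.
move=> Mm; have [_ [K mK]] := Mm.1; rewrite /determined.
(* This constant dominates |m z - t|, and the added 1 keeps it positive even when K and t vanish;
   dividing by its double keeps u within 1/2 of 1/2. *)
have L0 : 0 < K + `|t| + 1.
  by rewrite ltr_wpDl // addr_ge0 // (le_trans _ (mK 1%g)).
pose u z := 1 / 2 + (2 * (K + `|t| + 1))^-1 * (m z - t).
have Mu : multiplier u.
  apply: multiplierD; first exact: multiplier_cst.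
  apply: multiplierM; first exact: multiplier_cst.
  by apply: multiplierB => //; exact: multiplier_cst.
have u01 z : 0 <= u z <= 1.
  have : `|(2 * (K + `|t| + 1))^-1 * (m z - t)| <= 1 / 2.
    rewrite normrM (@ger0_norm _ _^-1) ?invr_ge0 ?mulr_ge0 ?(ltW L0) //.
    rewrite ler_pdivrMl ?mulr_gt0 // [leRHS](_ : _ = K + `|t| + 1); last by field.
    rewrite (le_trans (ler_normB _ _)) // (le_trans (lerD (mK z) (lexx _))) //.
    by rewrite lerDl.
  by rewrite ler_norml /u; lra.
have half_lt z : (u z < 1 / 2) = (m z < t).
  by rewrite /u gtrDl pmulr_rlt0 ?subr_lt0 // invr_gt0 mulr_gt0.
apply: (@multiplier_lim (fun n z => threshold n (u z)) _ 1) => [n|n z|z].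
- apply: multiplierM; apply: multiplierX || apply: multiplierB.
    by apply: multiplierB; [exact: multiplier_cst|exact: multiplierX].
    exact: multiplier_cst.
  apply: multiplierX; apply: multiplierB; first exact: multiplier_cst.
  by apply: multiplierX; apply: multiplierB => //; exact: multiplier_cst.
- exact: threshold_bound.
- have -> : \1_[set z | m z < t] z = ((u z < 1 / 2)%R%:R : R).
    rewrite half_lt indicE; congr ((nat_of_bool _)%:R).
    by apply/idP/idP; rewrite in_setE.
  exact: threshold_cvg.
Qed.

Let determined_setC A : determined A -> determined (~` A).
Proof.
move=> MA; rewrite /determined.
rewrite (_ : \1_(~` A) = fun z => cst 1 z - \1_A z :> R).
  by apply: multiplierB => //; exact: multiplier_cst.
apply/funext => z; rewrite indicC indicE.
by case: (z \in A); rewrite /= ?subrr ?subr0.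
Qed.

Let determined_setI A B : determined A -> determined B -> determined (A `&` B).
Proof. by move=> MA MB; rewrite /determined indicI; exact: multiplierM. Qed.

Let determined_setU A B : determined A -> determined B -> determined (A `|` B).
Proof.
move=> MA MB; rewrite -[A `|` B]setCK setCU.
by apply/determined_setC/determined_setI; exact: determined_setC.
Qed.

(** Finite unions come from complements and intersections; the indicator of a countable union is the
    bounded pointwise limit of those of its partial unions. *)
Let determined_sigma_algebra : sigma_algebra setT determined.
Proof.
split=> [|A|F MF].
- by rewrite /determined indic0; exact: (multiplier_cst 0).
- by rewrite setTD; exact: determined_setC.
- have MU n : determined (\bigcup_(i < n) F i).
    elim: n => [|n IHn].
      by rewrite II0 bigcup_set0 /determined indic0; exact: (multiplier_cst 0).
    by rewrite IIS bigcup_setU bigcup_set1; exact: determined_setU.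
  apply: (@multiplier_lim (fun n => \1_(\bigcup_(i < n) F i)) _ 1) => // [n z|z].
    by rewrite indicE; case: (_ \in _); rewrite ?normr0 ?normr1.
  have [[k _ Fk]|nF] := pselect ((\bigcup_i F i) z).
    (* The partial union runs over i < n, so it contains F k only from n = k + 1 on. *)
    apply: cvg_near_cst; exists k.+1 => // n /= kn.
    rewrite !indicE !mem_set //; first by exists k.
    by exists k.
  rewrite indicE memNset // (_ : (fun n => _) = cst 0); first exact: cvg_cst.
  apply/funext => n; rewrite indicE memNset // => -[k _ Fk].
  by apply: nF; exists k.
Qed.

(** [acos] is decreasing, so the set is {Im z <= 0} united with {Re z > cos t} for 0 < t <= pi, and
    {Im z <= 0} intersected with {Re z < cos t} for -pi < t <= 0; otherwise it is everything or
    empty. Re z and Im z are [c 1] and [s 1]. *)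
Let determined_arg_lt t : determined [set z | arg z < t].
Proof.
have c1E z : c 1 z = complex.Re z by rewrite /c mul1r -[in RHS](argK z).
have s1E z : s 1 z = complex.Im z by rewrite /s mul1r -[in RHS](argK z).
have zB z := @circle_Re_itv R z.
have zI (z : circle R) : complex.Re z \in `[-1, 1] by rewrite in_itv /= zB.
have aI (z : circle R) : acos (complex.Re z) \in `[0, pi].
  by rewrite in_itv /= acos_ge0 ?acos_lepi.
have acos_lt (z : circle R) r : 0 <= r <= pi ->
    (acos (complex.Re z) < r) = (cos r < complex.Re z).
  move=> rpi; have rI : r \in `[0, pi] by rewrite in_itv.
  by rewrite -(ltr_cos (aI z) rI) acosK.
have acos_gt (z : circle R) r : 0 <= r <= pi ->
    (r < acos (complex.Re z)) = (complex.Re z < cos r).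
  move=> rpi; have rI : r \in `[0, pi] by rewrite in_itv.
  by rewrite -(ltr_cos rI (aI z)) acosK.
have arg_ge (z : circle R) : - pi <= arg z.
  rewrite /arg; case: ifP => _; last by rewrite lerN2 acos_lepi.
  by rewrite (le_trans _ (acos_ge0 _)) // oppr_le0 pi_ge0.
have arg_le (z : circle R) : arg z <= pi.
  rewrite /arg; case: ifP => _; first by rewrite acos_lepi.
  by rewrite (le_trans _ (pi_ge0 R)) // oppr_le0 acos_ge0.
have lower : determined [set z : circle R | ~~ (0 < complex.Im z)].
  rewrite [X in determined X](_ : _ = ~` [set z | 0 - s 1 z < 0]).
    apply/determined_setC/determined_lt.
    by apply: multiplierB => //; exact: multiplier_cst.
  by apply/seteqP; split=> z /=; rewrite sub0r oppr_lt0 s1E => /negP.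
have [tpi|tpi] := ltP pi t.
  rewrite [X in determined X](_ : _ = ~` set0); last first.
    rewrite setC0; apply/seteqP; split=> // z _ /=.
    exact: le_lt_trans (arg_le z) tpi.
  by apply: determined_setC; have [] := determined_sigma_algebra.
have [t0|t0] := ltP 0 t.
  rewrite [X in determined X](_ : _ =
      [set z : circle R | ~~ (0 < complex.Im z)] `|` [set z | 0 - c 1 z < 0 - cos t]).
    apply: determined_setU => //; apply: determined_lt.
    by apply: multiplierB => //; exact: multiplier_cst.
  apply/seteqP; split=> z /=; rewrite !sub0r ltrN2 c1E /arg;
    case: ifP => Im0; rewrite ?acos_lt ?tpi ?ltW //=.
  + by right.
  + by left.
  + by case.
  + by move=> _; rewrite (le_lt_trans _ t0) // oppr_le0 acos_ge0.
have [tNpi|tNpi] := leP t (- pi).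
  rewrite [X in determined X](_ : _ = set0).
    by have [] := determined_sigma_algebra.
  apply/seteqP; split=> // z /= /lt_le_trans/(_ tNpi).
  by rewrite ltNge arg_ge.
rewrite [X in determined X](_ : _ =
    [set z : circle R | ~~ (0 < complex.Im z)] `&` [set z | c 1 z < cos t]).
  by apply: determined_setI => //; exact: determined_lt.
apply/seteqP; split=> z /=; rewrite c1E /arg; case: ifP => Im0 //=.
- by rewrite ltNge (le_trans t0) // acos_ge0.
- by rewrite ltrNl acos_gt ?cosN // oppr_ge0 t0 lerNl ltW.
- by case.
- by case=> _; rewrite ltrNl acos_gt ?cosN // oppr_ge0 t0 lerNl ltW.
Qed.

(** A Borel set A of the circle is the preimage under [arg] of the Borel set of all x with e^{ix} in
    A, so it suffices that the sets arg z < t are determined. *)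
Lemma fourier_unique (A : set (circle R)) : measurable A -> mu A = nu A.
Proof.
move=> mA.
have argD (B : set R) : measurable B -> determined (arg @^-1` B).
  (* The determined sets equal the sigma-algebra they generate, so [arg] can be shown measurable for
     it by looking at half-lines only. *)
  move=> mB; rewrite -(sigma_algebra_id determined_sigma_algebra).
  rewrite -[X in <<s _ >> X]setTI.
  have marg : measurable_fun setT (arg : g_sigma_algebraType determined -> R).
    apply: (measurability _ (RGenInftyO.measurableE R)).
    move=> _ [_ [t ->] <-]; rewrite setTI; apply: sub_sigma_algebra.
    rewrite /= [X in determined X](_ : _ = [set z | arg z < t]).
      exact: determined_arg_lt.
    by apply/seteqP; split=> z /=; rewrite in_itv.
  exact: marg.
have /argD : measurable (expi @^-1` A).
  by rewrite -[X in measurable X]setTI; exact: expi_measurable.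
rewrite [arg @^-1` _](_ : _ = A); last first.
  by apply/seteqP; split=> z /=; rewrite argK.
(* The indicator of A, as a multiplier, is applied to the constant function 1 and read at l = 0,
   where the cosine is 1. *)
move=> [_ /(_ _ equi1)[_ /(_ 0)[eq0 _]]].
have mE (rho : probability (circle R) R) :
    (\int[rho]_z (\1_A z * cst 1 z * c 0 z))%R = fine (rho A).
  under eq_Rintegral do rewrite /c mul0r cos0 !mulr1.
  by rewrite /Rintegral integral_indic // setIT.
move: eq0; rewrite !mE => eq0.
by rewrite -[LHS]fineK ?eq0 ?fineK //; exact: fin_num_measure.
Qed.

End fourier_uniqueness.

(** * Characteristic function of the normal law *)

Section normal_characteristic_function.
Context {R : realType}.
Notation mu := (@lebesgue_measure R).

(* If d_s F = d_x K, then the integral of F(s, -) over [a, b] changes with s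
   only through the flux of K at the endpoints. *)
Lemma Rintegral_flux (F k K : R -> R -> R) (a b t C M : R) : a < b ->
    (forall s x : R, is_derive s 1 (F^~ x) (k s x)) ->
    (forall s x : R, is_derive x 1 (K s) (k s x)) ->
    (forall s, continuous (F s)) -> (forall s, continuous (k s)) ->
    (forall s x, `|s| <= `|t| + 1 -> a <= x <= b -> `|k s x| <= C) ->
    (forall s, `|s| <= `|t| -> `|K s b - K s a| <= M) ->
  `|\int[mu]_(x in `[a, b]) F t x - \int[mu]_(x in `[a, b]) F 0 x| <= M * `|t|.
Proof.
move=> ab dF dK cF ck kC KM.
have intc (f : R -> R) : continuous f -> mu.-integrable `[a, b] (EFin \o f).
  move=> cf; apply: continuous_compact_integrable; first exact: segment_compact.
  exact: continuous_subspaceT.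
have C0 : 0 <= C.
  by apply: le_trans (kC 0 a _ _) => //; rewrite ?normr0 ?addr_ge0 // lexx ltW.
have FTC s : \int[mu]_(x in `[a, b]) k s x = K s b - K s a.
  have dKs x : derivable (K s) x 1 by have [] := dK s x.
  rewrite /Rintegral (@continuous_FTC2 _ (k s) (K s)) //=.
  - exact: continuous_subspaceT.
  - split=> [x _||] //.
      by apply/cvg_at_right_filter/differentiable_continuous/derivable1_diffP.
    by apply/cvg_at_left_filter/differentiable_continuous/derivable1_diffP.
  - by move=> x _; rewrite derive1E; have [] := dK s x.
pose I s := \int[mu]_(x in `[a, b]) F s x.
have partialE s x : partial1of2 F s x = k s x.
  by rewrite partial1of2E; have [] := dF s x.
(* Differentiation under the integral takes place on an open interval exceeding [-|t|, |t|] by 1 on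
   each side, where the constant C dominates; the result is the flux of K. *)
have dI (s : R) : `|s| <= `|t| -> is_derive s 1 I (K s b - K s a).
  move=> st.
  have sI : `](- (`|t| + 1)), (`|t| + 1)[%classic s.
    by rewrite /= in_itv /= -ltr_norml (le_lt_trans st) // ltrDl.
  have Fi r : `](- (`|t| + 1)), (`|t| + 1)[%classic r ->
    mu.-integrable `[a, b] (EFin \o F r) by move=> _; exact: intc.
  have Fd r x : `](- (`|t| + 1)), (`|t| + 1)[%classic r -> `[a, b]%classic x ->
    derivable (F^~ x) r 1 by move=> _ _; have [] := dF r x.
  have FC r x : `](- (`|t| + 1)), (`|t| + 1)[%classic r -> `[a, b]%classic x ->
      `|partial1of2 F r x| <= cst C x.
    rewrite /= !in_itv /= -ltr_norml partialE => rt xab.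
    by apply: kC => //; exact: ltW.
  have iC : mu.-integrable `[a, b] (EFin \o cst C).
    by apply: intc => x; exact: cvg_cst.
  apply: DeriveDef.
    exact: (derivable_under_integral _ sI Fi Fd (fun=> C0) iC FC).
  rewrite -derive1E (differentiation_under_integral _ sI Fi Fd (fun=> C0) iC FC) //.
  by under eq_Rintegral do rewrite partialE; exact: FTC.
(* The mean value theorem turns the flux bound into a Lipschitz bound, used between 0 and t in the
   order given by the sign of t. *)
have MVT_I (u v : R) : u <= v -> `|u| <= `|t| -> `|v| <= `|t| ->
    `|I v - I u| <= M * (v - u).
  move=> uv ut vt.
  have dIuv (x : R) : u <= x <= v -> is_derive x 1 I (K x b - K x a).
    move=> /andP[ux xv]; apply: dI; move: ut vt; rewrite !ler_norml; lra.
  have [||c cuv ->] := @MVT_segment _ I (fun s => K s b - K s a) u v uv.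
  - by move=> x; rewrite in_itv /= => /andP[ux xv]; apply: dIuv; rewrite !ltW.
  - apply: derivable_within_continuous => x; rewrite in_itv /= => /dIuv.
    by case.
  rewrite normrM (@ger0_norm _ (v - u)) ?subr_ge0 // ler_wpM2r ?subr_ge0 //.
  move: cuv; rewrite in_itv /= => /andP[uc cv].
  by apply: KM; move: ut vt; rewrite !ler_norml; lra.
have [t0|t0] := leP 0 t.
  rewrite (ger0_norm t0) -[X in M * X]subr0.
  by apply: MVT_I; rewrite // normr0.
rewrite distrC (ltr0_norm t0) -[X in M * X]add0r.
by apply: MVT_I; rewrite ?normr0 // ltW.
Qed.

Variable sigma : R.
Hypothesis sigma0 : sigma != 0.
Let g (x : R) : R := normal_fun 0 sigma x.

Let dg (x : R) : is_derive x 1 g (- (x / sigma ^+ 2) * g x).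
Proof.
have -> : g = expR \o (fun x => - (2 * sigma ^+ 2)^-1 * x ^+ 2).
  apply/funext => y; rewrite /g /normal_fun /= subr0; congr expR.
  by field.
apply: is_derive_eq; rewrite /GRing.scale /= mulr1 mulrC; congr (_ * _).
by field.
Qed.

Let g_gt0 x : 0 < g x. Proof. exact: expR_gt0. Qed.

Let g_le1 x : g x <= 1.
Proof.
rewrite -[leRHS]expR0 ler_expR mulNr oppr_le0 divr_ge0 ?sqr_ge0 //.
by rewrite mulrn_wge0 // sqr_ge0.
Qed.

Let cg : continuous g.
Proof.
by move=> x; have [? _] := dg x; apply/differentiable_continuous/derivable1_diffP.
Qed.

(** Reciprocal of the expected characteristic function at s; with this factor the integral of F s
    over the line will not depend on s. *)
Let w (s : R) : R := expR (sigma ^+ 2 * s ^+ 2 / 2).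

Let dw (s : R) : is_derive s 1 w (sigma ^+ 2 * s * w s).
Proof.
have -> : w = expR \o (fun s => sigma ^+ 2 / 2 * s ^+ 2).
  by apply/funext => y; rewrite /w /=; congr expR; field.
apply: is_derive_eq; rewrite /GRing.scale /= mulr1 mulrC; congr (_ * _).
by field.
Qed.

(** A phase that treats both parts of the characteristic function together: phi = 0 gives the cosine
    and phi = pi / 2 the sine. *)
Variable phi : R.
Let F s x := w s * (g x * cos (s * x - phi)).
Let k s x := w s * (g x * (sigma ^+ 2 * s * cos (s * x - phi) -
                           x * sin (s * x - phi))).
(** The primitive in x of k s, where k is the derivative of F in s. Its factor g makes the flux
    vanish at infinity. *)
Let K s x := sigma ^+ 2 * w s * (g x * sin (s * x - phi)).

Let dF (s x : R) : is_derive s 1 (F^~ x) (k s x).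
Proof.
have -> : F^~ x = w * (g x *: (@cos R \o (fun s => s * x - phi))) by [].
apply: is_derive_eq; rewrite /GRing.scale /k /= /GRing.scale /=.
by rewrite -/(w s); field.
Qed.

Let dK (s x : R) : is_derive x 1 (K s) (k s x).
Proof.
have -> : K s = sigma ^+ 2 * w s *: (g * (@sin R \o (fun x => s * x - phi))) by [].
apply: is_derive_eq; rewrite /GRing.scale /k /= /GRing.scale /=.
by rewrite -[expR _]/(g x); field.
Qed.

Let cF s : continuous (F s).
Proof.
move=> x; apply: cvgM; first exact: cvg_cst.
apply: cvgM; first exact: cg.
apply: continuous_comp; last exact: continuous_cos.
by apply: cvgB; [apply: cvgM; [exact: cvg_cst|exact: cvg_id]|exact: cvg_cst].
Qed.

Let ck s : continuous (k s).
Proof.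
have clin (x : R) : {for x, continuous (fun x => s * x - phi)}.
  by apply: cvgB; [apply: cvgM; [exact: cvg_cst|exact: cvg_id]|exact: cvg_cst].
move=> x; apply: cvgM; first exact: cvg_cst.
apply: cvgM; first exact: cg.
apply: cvgB; apply: cvgM; [exact: cvg_cst| |exact: cvg_id|].
- by apply: continuous_comp; [exact: clin|exact: continuous_cos].
- by apply: continuous_comp; [exact: clin|exact: continuous_sin].
Qed.

Let w_le (s t : R) : `|s| <= `|t| -> w s <= w t.
Proof.
move=> st; rewrite ler_expR ler_wpM2r // ler_wpM2l ?sqr_ge0 //.
by rewrite -(real_normK (num_real s)) -(real_normK (num_real t)) ler_sqr ?nnegrE.
Qed.

(** As g is even and sines are bounded by 1, the flux at s is at most 2 sigma^2 w(s) g(n + 1), and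
    w(s) <= w(t) for |s| <= |t|. Using n + 1 keeps the interval nondegenerate at n = 0. *)
Let F_flux (t : R) (n : nat) :
  `|\int[mu]_(x in `[- n.+1%:R, n.+1%:R]) F t x -
    \int[mu]_(x in `[- n.+1%:R, n.+1%:R]) F 0 x| <=
  2 * sigma ^+ 2 * w t * g n.+1%:R * `|t|.
Proof.
(* The constant bounds k for |s| <= |t| + 1 and |x| <= n + 1, using g <= 1. *)
apply: (@Rintegral_flux _ k K _ _ _
  (w (`|t| + 1) * (sigma ^+ 2 * (`|t| + 1) + n.+1%:R))) => //.
- by rewrite gtrN.
- move=> s x st /andP[nx xn]; rewrite normrM (ger0_norm (expR_ge0 _)).
  apply: ler_pM; rewrite ?expR_ge0 ?w_le // ?(ger0_norm (addr_ge0 _ _)) //.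
  rewrite normrM (gtr0_norm (g_gt0 x)) -[leRHS]mul1r; apply: ler_pM => //.
    exact: ltW.
  apply: (le_trans (ler_normB _ _)).
  rewrite (normrM (_ ^+ 2 * s)) (normrM (_ ^+ 2) s) (normrM x).
  rewrite (ger0_norm (sqr_ge0 _)) lerD //.
    rewrite -[leRHS]mulr1 ler_pM ?(mulr_ge0 (sqr_ge0 _)) //.
      by rewrite ler_wpM2l ?sqr_ge0.
    by rewrite ler_norml cos_geN1 cos_le1.
  rewrite -[leRHS]mulr1 ler_pM //; first by rewrite ler_norml nx xn.
  by rewrite ler_norml sin_geN1 sin_le1.
- move=> s st.
  have gN : g (- n.+1%:R) = g n.+1%:R by rewrite /g /normal_fun !subr0 sqrrN.
  rewrite /K gN -mulrBr -mulrBr normrM (normrM _ (w s)) (normrM (g _)).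
  rewrite (ger0_norm (sqr_ge0 _)).
  rewrite (ger0_norm (expR_ge0 _)) (gtr0_norm (g_gt0 _)).
  have sin1 y : `|sin y| <= 1 :> R by rewrite ler_norml sin_geN1 sin_le1.
  have sin2 : `|sin (s * n.+1%:R - phi) - sin (s * - n.+1%:R - phi)| <= 2.
    by rewrite (le_trans (ler_normB _ _)) // -[2]/(1 + 1) lerD.
  rewrite [leRHS](_ : _ = sigma ^+ 2 * w t * (g n.+1%:R * 2)); last by ring.
  rewrite ler_pM ?(mulr_ge0 (sqr_ge0 _)) ?(mulr_ge0 (ltW (g_gt0 _))) ?expR_ge0 //.
    by rewrite ler_wpM2l ?sqr_ge0 ?w_le.
  by rewrite ler_wpM2l // ltW.
Qed.

Let ig : mu.-integrable setT (EFin \o g).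
Proof.
rewrite (_ : EFin \o g = fun x =>
    ((normal_peak sigma)^-1%:E * (normal_pdf 0 sigma x)%:E)%E).
  by apply: integrableZl => //; exact: integrable_normal_pdf.
apply/funext => x; rewrite normal_pdfE //= -EFinM mulKf //.
by rewrite gt_eqF // normal_peak_gt0.
Qed.

Let iF s : mu.-integrable setT (EFin \o F s).
Proof.
apply: (le_integrable measurableT _ _ (integrableZl measurableT (w s) ig)).
  by apply/measurable_EFinP; apply: continuous_measurable_fun; exact: cF.
move=> x _; rewrite /= lee_fin /F !normrM; apply: ler_wpM2l => //.
by rewrite -[leRHS]mulr1 ler_wpM2l // ler_norml cos_geN1 cos_le1.
Qed.

Let F_cvg s : \int[mu]_(x in `[- n.+1%:R, n.+1%:R]) F s x @[n --> \oo] -->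
  \int[mu]_x F s x.
Proof.
pose D n : set R := `[- n.+1%:R, n.+1%:R]%classic.
have mF : measurable_fun setT (F s).
  by apply: continuous_measurable_fun; exact: cF.
have [|||||intf _ ic] := @dominated_convergence _ _ _ mu setT measurableT
    (fun n => EFin \o (F s \_ (D n))) (EFin \o F s) (fun x => `|(F s x)%:E|%E).
- move=> n; apply/measurable_EFinP/(measurable_restrictT _ (measurable_itv _)).
  exact: measurable_funTS.
- exact/measurable_EFinP.
- apply: aeW => x _; apply: cvg_near_cst; exists (Num.truncn `|x|) => // n /= xn.
  have : D n x.
    rewrite /D /= in_itv /= -ler_norml ltW // (lt_le_trans (truncnS_gt _)) //.
    by rewrite ler_nat.
  by move=> Dx; rewrite patchE mem_set.
- exact: (integrable_abse (iF s)).
- apply: aeW => x n _; rewrite /= lee_fin patchE; case: ifP => //.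
  by rewrite normr0.
under eq_fun do rewrite Rintegral_mkcond.
by apply: fine_cvg; rewrite fineK //; exact: integrable_fin_num intf.
Qed.

(** From e^y >= 1 + y at y = (n + 1)^2 / (2 sigma^2), g(n + 1) is at most 2 sigma^2 / (n + 1)^2. *)
Let g_cvg0 : g n.+1%:R @[n --> \oo] --> (0 : R).
Proof.
apply: (@squeeze_cvgr _ _ _ _ (cst 0) (fun n => (2 * sigma ^+ 2) * harmonic n)).
- apply: nearW => n; rewrite ltW //= /g /normal_fun subr0 mulNr expRN.
  have s0 : 0 < sigma ^+ 2 *+ 2 by rewrite mulrn_wgt0 // exprn_even_gt0.
  have n0 : 0 < n.+1%:R :> R by [].
  rewrite /harmonic -[2 * _]/(2 * _) mulr_natl -[leRHS]invrK lef_pV2 ?posrE.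
  + apply: (le_trans _ (expR_ge1Dx _)).
    rewrite invfM invrK mulrC ler_wpDl // ler_wpM2r ?invr_ge0 ?(ltW s0) //.
    by rewrite expr2 ler_peMl // ler1n.
  + exact: expR_gt0.
  + by rewrite invr_gt0 divr_gt0.
- exact: cvg_cst.
- rewrite -[X in _ --> X](mulr0 (2 * sigma ^+ 2)).
  by apply: cvgM; [exact: cvg_cst|exact: cvg_harmonic].
Qed.

(** The flux through the endpoints of [-(n + 1), n + 1] vanishes in the limit, so F t and F 0 have
    the same integral. At s = 0 the integrand is g(x) cos phi, and the normal density is g times its
    peak value. *)
Lemma Rintegral_cos_normal_pdf (t : R) :
  \int[mu]_x (cos (t * x - phi) * normal_pdf 0 sigma x) =
  cos phi * expR (- (sigma ^+ 2 * t ^+ 2 / 2)).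
Proof.
have Ft0 : \int[mu]_x F t x = \int[mu]_x F 0 x.
  pose I s n := \int[mu]_(x in `[- n.+1%:R, n.+1%:R]) F s x.
  have It_cvg : I t n @[n --> \oo] --> \int[mu]_x F 0 x.
    have flux0 : (I t n - I 0 n) @[n --> \oo] --> (0 : R).
      apply: norm_cvg0; apply: (@squeeze_cvgr _ _ _ _ (cst 0)
        (fun n => 2 * sigma ^+ 2 * w t * g n.+1%:R * `|t|)).
      - by apply: nearW => n; rewrite normr_ge0 F_flux.
      - exact: cvg_cst.
      - rewrite -[X in _ --> X](mul0r `|t|) -(mulr0 (2 * sigma ^+ 2 * w t)).
        apply: cvgM; last exact: cvg_cst.
        by apply: cvgM; [exact: cvg_cst|exact: g_cvg0].
    rewrite -[X in _ --> X]add0r; under eq_fun => n do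
      rewrite -(subrK (I 0 n) (I t n)).
    by apply: cvgD => //; exact: F_cvg.
  exact: (cvg_unique (@Rhausdorff R) (@F_cvg t) It_cvg).
have peak0 : normal_peak sigma != 0 by rewrite gt_eqF // normal_peak_gt0.
have -> : \int[mu]_x (cos (t * x - phi) * normal_pdf 0 sigma x) =
    expR (- (sigma ^+ 2 * t ^+ 2 / 2)) * normal_peak sigma * \int[mu]_x F t x.
  rewrite -RintegralZl //; apply: eq_Rintegral => x _.
  rewrite normal_pdfE // /F -/(g x) /w expRN.
  by field; rewrite gt_eqF // expR_gt0.
have -> : \int[mu]_x F t x = cos phi / normal_peak sigma.
  rewrite Ft0.
  have -> : \int[mu]_x F 0 x =
      (cos phi / normal_peak sigma) * \int[mu]_x normal_pdf 0 sigma x.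
    rewrite -RintegralZl //; last exact: integrable_normal_pdf.
    apply: eq_Rintegral => x _; rewrite normal_pdfE // /F -/(g x) /w.
    rewrite mul0r sub0r cosN expr0n /= mulr0 mul0r expR0.
    by field.
  by rewrite /Rintegral integral_normal_pdf mulr1.
by field.
Qed.

End normal_characteristic_function.

(** * The Poisson and Gauss factors *)

Section change_of_measure.
Local Open Scope ereal_scope.

(* No integrability is required: both sides are the difference of the integrals
   of the positive and the negative part. *)
Lemma Rintegral_image d1 d2 (S : measurableType d1) (T : measurableType d2)
    (R : realType) (mu : {measure set S -> \bar R})
    (nu : {measure set T -> \bar R}) (phi : S -> T) (f : T -> R) :
    measurable_fun setT phi ->
    (forall A, measurable A -> nu A = mu (phi @^-1` A)) ->
    measurable_fun setT f ->
  (\int[nu]_y f y = \int[mu]_x f (phi x))%R.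
Proof.
move=> mphi nuE mf; congr fine; pose g := EFin \o f.
have mg : measurable_fun setT g by exact/measurable_EFinP.
have nu_pos (k : T -> \bar R) : measurable_fun setT k -> (forall y, 0 <= k y) ->
    \int[nu]_y k y = \int[mu]_x (k \o phi) x.
  move=> mk k0.
  have := ge0_integral_pushforward mphi mu measurableT mk (fun y _ => k0 y).
  rewrite preimage_setT => <-.
  by apply: eq_measure_integral => A mA _; exact: nuE.
rewrite [LHS]integralE [RHS]integralE -[fun x => (f (phi x))%:E]/(g \o phi).
rewrite [X in _ = X - _](_ : _ = \int[mu]_x (g^\+ \o phi) x); last first.
  by rewrite -funepos_comp.
rewrite [X in _ = _ - X](_ : _ = \int[mu]_x (g^\- \o phi) x); last first.
  by rewrite -funeneg_comp.
congr (_ - _); apply: nu_pos => //.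
- exact: measurable_funepos.
- exact: measurable_funeneg.
Qed.

Lemma eq_measure_Rintegral d (T : measurableType d) (R : realType)
    (mu nu : {measure set T -> \bar R}) (f : T -> R) :
    (forall A, measurable A -> mu A = nu A) ->
  (\int[mu]_x f x = \int[nu]_x f x)%R.
Proof.
by move=> mu_nu; congr fine; apply: eq_measure_integral => A mA _; exact: mu_nu.
Qed.

(* [R] and [measurableTypeR R] carry the same sigma-algebra under different
   displays; laws of random variables live on the former, measures with a
   density on the latter. *)
Lemma Rintegral_density (R : realType) (nu : {measure set R -> \bar R})
    (Q : probability (measurableTypeR R) R) (p : measurableTypeR R -> R)
    (f : R -> R) :
    (forall A : set R, measurable A -> nu A = Q A) ->
    Q `<< (@lebesgue_measure R) ->
    lebesgue_measure.-integrable setT (EFin \o p) ->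
    (forall A, measurable A -> Q A = \int[lebesgue_measure]_(x in A) (p x)%:E) ->
    bounded_measurable f ->
  (\int[nu]_x f x = \int[lebesgue_measure]_x (f x * p x))%R.
Proof.
move=> nuQ Q_mu ip QE bf.
have bf' : bounded_measurable (f : measurableTypeR R -> R) by exact: bf.
have -> : (\int[nu]_x f x = \int[Q]_x f x)%R.
  rewrite (@Rintegral_image _ _ _ _ _ Q _ (id : measurableTypeR R -> R)) //.
  exact: bf.1.
congr fine.
rewrite -(Radon_Nikodym_change_of_variables Q_mu) //; last first.
  exact: bounded_measurable_integrable.
have mf : measurable_fun setT (EFin \o (f : measurableTypeR R -> R)).
  by apply/measurable_EFinP; exact: bf'.1.
have mp := measurable_int _ ip.
apply: ae_eq_integral => //.
- by apply: emeasurable_funM => //; apply: measurable_int;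
    exact: Radon_Nikodym_integrable.
- by apply/measurable_EFinP/measurable_funM; [exact: bf'.1|exact/measurable_EFinP].
under [X in ae_eq _ _ _ X]eq_fun do rewrite EFinM.
apply: ae_eqe_mul2l.
(* The Radon-Nikodym derivative and p both integrate to Q A over every measurable A, so they agree
   almost everywhere. *)
apply: integral_ae_eq => // [|A _ mA].
  exact: Radon_Nikodym_integrable.
by rewrite -Radon_Nikodym_integral // -QE.
Qed.

End change_of_measure.

Section law_of_expi.
Context {R : realType}.

Lemma bounded_measurable_cos (t : R) : bounded_measurable (fun x => cos (t * x)).
Proof.
split; last by exists 1 => x; rewrite ler_norml cos_geN1 cos_le1.
apply: measurableT_comp; last by apply: measurable_funM.
by apply: continuous_measurable_fun; exact: continuous_cos.
Qed.

Lemma bounded_measurable_sin (t : R) : bounded_measurable (fun x => sin (t * x)).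
Proof.
split; last by exists 1 => x; rewrite ler_norml sin_geN1 sin_le1.
apply: measurableT_comp; last by apply: measurable_funM.
by apply: continuous_measurable_fun; exact: continuous_sin.
Qed.

Lemma measurable_Re_chiT (l : int) :
  measurable_fun setT (fun z : circle R => complex.Re (chiT l z)).
Proof.
under eq_fun do rewrite chiT_arg /=.
exact: (measurableT_comp (bounded_measurable_cos _).1 arg_measurable).
Qed.

Lemma measurable_Im_chiT (l : int) :
  measurable_fun setT (fun z : circle R => complex.Im (chiT l z)).
Proof.
under eq_fun do rewrite chiT_arg /=.
exact: (measurableT_comp (bounded_measurable_sin _).1 arg_measurable).
Qed.

(** Both integrals pull back to [Omega], where chi_l(e^{ix}) = e^{ilx}. *)
Lemma cintegral_expi_chiT d (Omega : measurableType d) (P : probability Omega R)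
    (X : {RV P >-> R}) (l : int) :
  cintegral (distribution P (expi \o X)) (chiT l) =
  cintegral (distribution P X) (chiR l%:~R).
Proof.
rewrite /cintegral.
have -> : (\int[distribution P (expi \o X)]_z complex.Re (chiT l z) =
           \int[distribution P X]_x complex.Re (chiR l%:~R x)).
  rewrite (@Rintegral_image _ _ _ _ _ P _ (expi \o X)) //.
  - rewrite (@Rintegral_image _ _ _ _ _ P _ X) //.
    + by apply: eq_Rintegral => t _; rewrite /= chiT_expi.
    + exact: (bounded_measurable_cos _).1.
  - exact: measurable_Re_chiT.
have -> : (\int[distribution P (expi \o X)]_z complex.Im (chiT l z) =
           \int[distribution P X]_x complex.Im (chiR l%:~R x)).
  rewrite (@Rintegral_image _ _ _ _ _ P _ (expi \o X)) //.
  - rewrite (@Rintegral_image _ _ _ _ _ P _ X) //.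
    + by apply: eq_Rintegral => t _; rewrite /= chiT_expi.
    + exact: (bounded_measurable_sin _).1.
  - exact: measurable_Im_chiT.
by [].
Qed.

Lemma law_expi_poisson d (Omega : measurableType d) (P : probability Omega R)
    (Y : {RV P >-> R}) (eta : {measure set (circle R) -> \bar R})
    (ppi : probability (circle R) R) :
    generalized_poisson chiR gR (arg_image eta) (distribution P Y) ->
    generalized_poisson chiT gT eta ppi ->
  forall A, measurable A -> distribution P (expi \o Y) A = ppi A.
Proof.
move=> hY hppi; apply: fourier_unique => l.
rewrite cintegral_expi_chiT hY hppi; congr expc; rewrite /cintegral.
(* The imaginary part of the exponent contains h, so transporting it along [arg] requires h to be
   measurable. *)
have mh : measurable_fun setT (@h_saw R).
  rewrite /h_saw; apply: measurable_fun_ifT => //.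
  - by apply: measurable_or; [exact: measurable_fun_ltr|exact: measurable_fun_ler].
  - apply: measurable_fun_ifT.
    + exact: measurable_fun_ltr.
    + by apply: measurable_funB => //; exact: measurable_funN.
    + apply: measurable_fun_ifT => //; first exact: measurable_fun_ltr.
      by apply: measurable_funD => //; exact: measurable_funN.
congr Complex.
  rewrite [LHS](@Rintegral_image _ _ _ _ _ eta _ arg) //.
    by apply: eq_Rintegral => z _; rewrite chiT_arg.
  rewrite (_ : (fun x => _) = fun x => cos (l%:~R * x) - 1).
    by apply: measurable_funB => //; exact: (bounded_measurable_cos _).1.
  by apply/funext => x; rewrite /= oppr0 addr0.
rewrite [LHS](@Rintegral_image _ _ _ _ _ eta _ arg) //.
  by apply: eq_Rintegral => z _; rewrite chiT_arg.
rewrite (_ : (fun x => _) = fun x => sin (l%:~R * x) - l%:~R * h_saw x).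
  apply: measurable_funB; first exact: (bounded_measurable_sin _).1.
  exact: measurable_funM.
by apply/funext => x; rewrite /= subr0.
Qed.

End law_of_expi.

Section gauss_law.
Context {R : realType}.
Local Open Scope complex_scope.

Lemma law_expi_gauss d (Omega : measurableType d) (P : probability Omega R)
    (X : {RV P >-> R}) (b : R) (gamma : probability (circle R) R) : 0 <= b ->
    (forall B : set R, measurable B -> distribution P X B = centered_normal b B) ->
    gauss_circle b gamma ->
  forall A, measurable A -> distribution P (expi \o X) A = gamma A.
Proof.
move=> b0 hX hgamma; apply: fourier_unique => l.
rewrite cintegral_expi_chiT hgamma /cintegral /psi /=.
(* For b = 0 the law is a Dirac mass at 0; the computation with a density applies to b > 0. *)
have [b_eq0|b_neq0] := eqVneq b 0.
  have lawE (f : R -> R) : measurable_fun setT f ->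
      (\int[distribution P X]_x f x = f 0)%R.
    move=> mf; rewrite (@eq_measure_Rintegral _ _ _ _ (\d_(0 : R))).
      rewrite /Rintegral integral_dirac // ?diracT ?mul1e //.
      exact/measurable_EFinP.
    by move=> B mB; apply: (etrans (hX B mB)); rewrite /centered_normal b_eq0 eqxx.
  rewrite !lawE ?mulr0 ?cos0 ?sin0 ?b_eq0 ?mul0r ?oppr0 ?mul0r ?expR0 //.
  - exact: (bounded_measurable_sin _).1.
  - exact: (bounded_measurable_cos _).1.
have s0 : Num.sqrt b != 0 by rewrite gt_eqF // sqrtr_gt0 lt_neqAle eq_sym b_neq0.
have lawE (f : R -> R) : bounded_measurable f ->
    (\int[distribution P X]_x f x =
     \int[lebesgue_measure]_x (f x * normal_pdf 0 (Num.sqrt b) x))%R.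
  move=> bf; apply: (@Rintegral_density _ _ (normal_prob 0 (Num.sqrt b))) => //.
  - move=> B mB; apply: (etrans (hX B mB)).
    by rewrite /centered_normal (negbTE b_neq0).
  - exact: normal_prob_dominates.
  - exact: integrable_normal_pdf.
rewrite !lawE; [|exact: bounded_measurable_sin|exact: bounded_measurable_cos].
(* Sine is cosine with phase pi / 2, whose cosine is 0, so the imaginary part vanishes; the real
   part has phase 0. *)
have pi2 (x : R) : sin x = cos (x - pi / 2).
  by rewrite cosB cos_pihalf sin_pihalf; ring.
under [X in _ +i* X]eq_Rintegral do rewrite pi2.
under [X in X +i* _]eq_Rintegral do rewrite -[X in cos X]subr0.
rewrite !Rintegral_cos_normal_pdf // cos0 cos_pihalf mul0r mul1r sqr_sqrtr //.
by rewrite mulNr.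
Qed.

End gauss_law.

(** * Haar measures of compact subgroups *)

Section haar_circle.
Context {R : realType}.
Local Open Scope complex_scope.

Lemma bounded_measurable_Re_chiT (l : int) :
  bounded_measurable (fun z : circle R => complex.Re (chiT l z)).
Proof.
split; first exact: measurable_Re_chiT.
by exists 1 => z; rewrite chiT_arg ler_norml cos_geN1 cos_le1.
Qed.

Lemma bounded_measurable_Im_chiT (l : int) :
  bounded_measurable (fun z : circle R => complex.Im (chiT l z)).
Proof.
split; first exact: measurable_Im_chiT.
by exists 1 => z; rewrite chiT_arg ler_norml sin_geN1 sin_le1.
Qed.

Lemma chiTM (l : int) (z w : circle R) : chiT l (z * w)%g = chiT l z * chiT l w.
Proof.
by rewrite -(argK z) -(argK w) -expiD !chiT_expi mulrDr expiD.
Qed.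

Lemma cintegral_chiT0 (mu : probability (circle R) R) : cintegral mu (chiT 0) = 1.
Proof.
rewrite /cintegral /chiT; congr Complex.
  under eq_Rintegral do rewrite expr0z.
  rewrite Rintegral_cst; last exact: measurableT.
  by rewrite [X in fine X](_ : _ = 1%E) ?mulr1 //; exact: probability_setT.
under eq_Rintegral do rewrite expr0z.
rewrite Rintegral_cst; last exact: measurableT.
by rewrite mul0r.
Qed.

Lemma measurable_mulgl (w : circle R) :
  measurable_fun setT (fun z : circle R => (w * z)%g).
Proof.
rewrite (_ : (fun z => _) = expi \o (fun z => arg w + arg z)).
  apply: measurableT_comp; first exact: expi_measurable.
  by apply: measurable_funD => //; exact: arg_measurable.
by apply/funext => z /=; rewrite expiD !argK.
Qed.

(** Translation by w = e^{i pi / l} preserves omega, while chi_l(w) = -1 changes the sign of chi_l,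
    so the integral equals its own negative. *)
Lemma cintegral_haar_circle (omega : probability (circle R) R) (l : int) :
  haar setT omega -> l != 0 -> cintegral omega (chiT l) = 0.
Proof.
move=> [_ inv] l0; pose w : circle R := expi (pi / l%:~R).
have chiw z : chiT l (w * z)%g = - chiT l z.
  rewrite chiTM -[RHS]mulN1r; congr (_ * _).
  rewrite chiT_expi mulrC divfK ?intr_eq0 //.
  by apply/eqP; rewrite eq_complex /= cospi sinpi oppr0 !eqxx.
have vanish (f : circle R -> R) : bounded_measurable f ->
    (forall z, f (w * z)%g = - f z) -> (\int[omega]_z f z = 0)%R.
  move=> bf fN; have : (\int[omega]_z f z = - \int[omega]_z f z)%R.
    rewrite [LHS](@Rintegral_image _ _ _ _ _ omega _ (fun z => (w * z)%g)) //.
    - under eq_Rintegral do rewrite fN -mulN1r.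
      by rewrite RintegralZl ?mulN1r //; exact: bounded_measurable_integrable.
    - exact: measurable_mulgl.
    - by move=> A mA; apply/esym; exact: inv.
    - exact: bf.1.
  by move=> /eqP; rewrite -addr_eq0 -mulr2n mulrn_eq0 /= => /eqP.
rewrite /cintegral (vanish _ (bounded_measurable_Re_chiT l)); last first.
  by move=> z; rewrite chiw; case: (chiT l z).
rewrite (vanish _ (bounded_measurable_Im_chiT l)) //.
by move=> z; rewrite chiw; case: (chiT l z).
Qed.

Lemma expi_int_2pi (l : int) : expi (l%:~R * (2 * pi)) = 1%g :> circle R.
Proof.
apply/val_inj; rewrite -[LHS]/(expi _ : R[i]) -chiT_expi /chiT.
have -> : (expi (2 * pi) : R[i]) = 1.
  by apply/eqP; rewrite eq_complex /= mulr_natl cos2pi sin2pi !eqxx.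
by rewrite exp1rz.
Qed.

(** The density is constant on [0, 2 pi], and for l <> 0 the primitives of cos(l x) and sin(l x)
    take equal values at the two ends. *)
Lemma cintegral_uniform_circle d (Omega : measurableType d)
    (P : probability Omega R) (U : {RV P >-> R}) (l : int) :
    (forall B : set R, measurable B ->
      distribution P U B = uniform_prob two_pi_gt0 B) -> l != 0 ->
  cintegral (distribution P (expi \o U)) (chiT l) = 0.
Proof.
move=> hU l0; rewrite cintegral_expi_chiT.
have l0R : l%:~R != 0 :> R by rewrite intr_eq0.
have twopi0 : 2 * pi != 0 :> R by rewrite gt_eqF // two_pi_gt0.
have lawE (f F : R -> R) : bounded_measurable f -> continuous f ->
    (forall x : R, is_derive x 1 F (f x)) -> F (2 * pi) = F 0 ->
    (\int[distribution P U]_x f x = 0)%R.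
  move=> bf cf dF Fper.
  rewrite (@Rintegral_density _ _ (uniform_prob two_pi_gt0)
    (uniform_pdf 0 (2 * pi))) //; last 2 first.
  - exact: dominates_uniform_prob.
  - by apply: integrable_uniform_pdf; exact: two_pi_gt0.
  transitivity ((2 * pi)^-1 * \int[lebesgue_measure]_(x in `[0, 2 * pi]) f x)%R.
    rewrite -RintegralZl //; last first.
      apply: continuous_compact_integrable; first exact: segment_compact.
      exact: continuous_subspaceT.
    rewrite [RHS]Rintegral_mkcond; apply: eq_Rintegral => x _.
    rewrite patchE mem_setE in_itv /= /uniform_pdf subr0.
    by case: ifP => _; rewrite ?mulr0 // mulrC.
  have dFx x : derivable F x 1 by have [] := dF x.
  rewrite /Rintegral (@continuous_FTC2 _ f F) ?two_pi_gt0 //=.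
  - by rewrite Fper subrr mulr0.
  - exact: continuous_subspaceT.
  - split=> [x _||] //.
      by apply/cvg_at_right_filter/differentiable_continuous/derivable1_diffP.
    by apply/cvg_at_left_filter/differentiable_continuous/derivable1_diffP.
  - by move=> x _; rewrite derive1E; have [] := dF x.
have [cos1 sin0'] : cos (l%:~R * (2 * pi)) = 1 :> R /\
    sin (l%:~R * (2 * pi)) = 0 :> R.
  by have /(congr1 (fun z : circle R => (z : R[i]))) [] := expi_int_2pi l.
have clin (x : R) : {for x, continuous ( *%R (l%:~R : R))}.
  by apply: cvgM; [exact: cvg_cst|exact: cvg_id].
congr Complex.
  apply: (lawE _ (fun x => l%:~R^-1 * sin (l%:~R * x))).
  - exact: bounded_measurable_cos.
  - by move=> x; apply: continuous_comp; [exact: clin|exact: continuous_cos].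
  - move=> x; rewrite (_ : (fun x => _) =
      l%:~R^-1 *: (@sin R \o ( *%R l%:~R))) //.
    by apply: is_derive_eq; rewrite /GRing.scale /= /GRing.scale /=; field.
  - by rewrite sin0' !mulr0 sin0 mulr0.
apply: (lawE _ (fun x => - l%:~R^-1 * cos (l%:~R * x))).
- exact: bounded_measurable_sin.
- by move=> x; apply: continuous_comp; [exact: clin|exact: continuous_sin].
- move=> x; rewrite (_ : (fun x => _) =
    - l%:~R^-1 *: (@cos R \o ( *%R l%:~R))) //.
  by apply: is_derive_eq; rewrite /GRing.scale /= /GRing.scale /=; field.
- by rewrite cos1 mulr0 cos0.
Qed.

End haar_circle.

(** * Closed subgroups of the real line *)

Section compact_subgroups.
Context {R : realType}.

(** If the positive elements have a least one c, division with remainder gives L = c Z. Otherwise L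
    has arbitrarily small positive elements, so it is dense, and being closed it is the whole
    line. *)
Lemma closed_subgroup_real (L : set R) : closed L -> L 0 ->
    (forall x y, L x -> L y -> L (x - y)) -> (exists2 p : R, 0 < p & L p) ->
  L = setT \/ exists2 c : R, 0 < c & L = [set c * n%:~R | n in [set: int]].
Proof.
move=> clL L0 LB [p p0 Lp].
have LN x : L x -> L (- x) by move=> Lx; rewrite -sub0r; exact: LB.
have LMn x (n : nat) : L x -> L (x * n%:R).
  move=> Lx; elim: n => [|n IHn]; first by rewrite mulr0.
  by rewrite -natr1 mulrDr mulr1 -[x in _ + x]opprK; apply: LB => //; exact: LN.
have LMz x (n : int) : L x -> L (x * n%:~R).
  move=> Lx; case: n => n; first exact: LMn.
  by rewrite NegzE rmorphN mulrN; exact/LN/LMn.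
have rem (x y : R) : 0 < x -> 0 <= y - x * (Num.floor (y / x))%:~R < x.
  move=> x0; have := floor_le (y / x); have := floorD1_gt (y / x).
  by rewrite intrD1 ler_pdivlMr // ltr_pdivrMr //; lra.
pose S := [set x | L x /\ 0 < x].
have [[c [[Lc c0] cmin]]|nomin] := pselect (exists c, S c /\ lbound S c).
  right; exists c => //; apply/seteqP; split=> [y Ly|_ [n _ <-]]; last exact: LMz.
  exists (Num.floor (y / c)) => //; have /andP[z0 zc] := rem c y c0.
  apply/esym/eqP; rewrite -subr_eq0 eq_le z0 andbT leNgt; apply/negP => zpos.
  have Lz : L (y - c * (Num.floor (y / c))%:~R) by apply: LB => //; exact: LMz.
  by have := cmin _ (conj Lz zpos); rewrite leNgt zc.
left; have infS : has_inf S.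
  by split; [exists p|exists 0 => x [_ /ltW]].
have small (e : R) : 0 < e -> exists2 x, S x & x < e.
  move=> e0; have [m0|m0] := ltP 0 (inf S); last first.
    have [x Sx xe] := inf_adherent e0 infS; exists x => //.
    by rewrite (lt_le_trans xe) // gerDr.
  (* With m = inf S > 0 and no minimum, there are x < 2m and x' < x in S. Both x' and x - x' lie in
     S, hence are at least m, which contradicts x < 2m. *)
  have [x [Lx x0] xm] := inf_adherent m0 infS.
  have [x' [Lx' x'0] x'x] : exists2 x', S x' & x' < x.
    apply: contrapT => nx'; apply: nomin; exists x; split=> // y Sy.
    by rewrite leNgt; apply/negP => yx; apply: nx'; exists y.
  have Sxx' : S (x - x') by split; [exact: LB|rewrite subr_gt0].
  have := ge_inf infS.2 Sxx'; have := ge_inf infS.2 (conj Lx' x'0); lra.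
apply/seteqP; split=> // y _; apply: clL => B /nbhs_ballP[e e0 yB].
have [x [Lx x0] xe] := small e e0.
(* The largest multiple of x not exceeding y is within x < e of y. *)
exists (x * (Num.floor (y / x))%:~R); split; first exact: LMz.
apply: yB; rewrite /ball /= ltr_norml.
have := rem x y x0; lra.
Qed.

End compact_subgroups.

(** * Haar measure on the roots of unity *)

Section finite_haar.
Context {R : realType}.

Lemma measurable_set1_circle (w : circle R) : measurable [set w].
Proof.
rewrite (_ : [set w] = setT `&` arg @^-1` [set arg w]).
  by apply: arg_measurable => //; exact: measurable_set1.
rewrite setTI; apply/seteqP; split=> z /= => [->//|].
exact: (can_inj (@argK R)).
Qed.

Let root (r j : nat) : circle R := expi (2 * pi * j%:R / r%:R).

Let root_inj r i j : (i < r)%N -> (j < r)%N -> root r i = root r j -> i = j.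
Proof.
move=> ir jr; have r0 : 0 < r%:R :> R by rewrite ltr0n (leq_ltn_trans _ ir).
have itv k : (k < r)%N -> - (pi : R) <= 2 * (pi : R) * k%:R / r%:R - pi < pi.
  move=> kr; suff : 0 <= 2 * (pi : R) * k%:R / r%:R < 2 * pi by lra.
  rewrite divr_ge0 ?mulr_ge0 ?pi_ge0 //=.
  by rewrite ltr_pdivrMr // ltr_pM2l ?two_pi_gt0 // ltr_nat.
(* Multiplication by e^{-i pi} moves the angles from [0, 2 pi) to [-pi, pi), where [arg] inverts
   [expi]. *)
move=> /(congr1 (fun z => arg (z * expi (- pi))%g)).
rewrite /root -!expiD !expiK ?itv // => /addIr.
move=> /(mulIf (invr_neq0 (lt0r_neq0 r0)))/(mulfI (lt0r_neq0 two_pi_gt0))/eqP.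
by rewrite eqr_nat => /eqP.
Qed.

(** Translation by a root carries its mass to that of 1, so all r roots weigh the same; the total is
    1 and nothing lies outside H, so each weighs 1/r. *)
Lemma haar_roots_of_unity (r : nat) (omega : probability (circle R) R) :
    (0 < r)%N -> haar (roots_of_unity r) omega ->
  forall A, measurable A -> uniform_grid r (expi @^-1` A) = omega A.
Proof.
move=> r0 [omegaH inv].
have H1 j : (j < r)%N -> roots_of_unity r (root r j) by move=> jr; exists j.
have root0 : root r 0 = 1%g by rewrite /root mulr0 mul0r expi0.
have omega1 (j : 'I_r) : omega [set root r j] = omega [set 1%g].
  rewrite -(inv (root r j)) //; first last.
  - by move=> _ ->; exact: H1.
  - exact: measurable_set1_circle.
  - exact: H1.
  congr (omega _); apply/seteqP; split=> z /= => [|->]; last by rewrite mulg1.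
  by move=> /(canRL (mulKg _)); rewrite mulVg.
have HE : roots_of_unity r = \bigcup_(j < r) [set root r j].
  by rewrite bigcup_imset1.
have mH : measurable (roots_of_unity r : set (circle R)).
  by rewrite HE; apply: bigcup_measurable => j _; exact: measurable_set1_circle.
have omegaNH A : measurable A -> omega (A `\` roots_of_unity r) = 0%E.
  move=> mA; apply/eqP; rewrite eq_le measure_ge0 andbT.
  have <- : omega (~` roots_of_unity r) = 0%E.
    by rewrite probability_setC // omegaH subee.
  by apply: le_measure; rewrite ?inE; [exact: measurableD|exact: measurableC|].
have omegaE A : measurable A ->
    omega A = (\sum_(j < r) (\1_A (root r j) : R)%:E * omega [set 1%g])%E.
  move=> mA; have -> : omega A = omega (A `&` roots_of_unity r).
    have -> : omega A = (omega (A `\` roots_of_unity r) +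
        omega (A `&` roots_of_unity r))%E by exact: measureDI.
    by rewrite omegaNH // add0e.
  rewrite HE setI_bigcupr bigcup_mkord measure_bigsetU_ord.
  - apply: eq_bigr => j _; rewrite indicE; have [Aj|nAj] := boolP (_ \in A).
      rewrite mul1e -(omega1 j) setIidr // => _ ->; exact: set_mem.
    rewrite mul0e (_ : _ `&` _ = set0) ?measure0 //.
    by apply/seteqP; split=> // z [Az zj]; move/negP: nAj; apply; rewrite -zj inE.
  - by move=> j; apply: measurableI => //; exact: measurable_set1_circle.
  - move=> i j _ _ [z [[_ zi] [_ zj]]]; apply/val_inj.
    exact: (root_inj (ltn_ord i) (ltn_ord j) (etrans (esym zi) zj)).
have omega1E : omega [set 1%g] = (r%:R^-1)%:E.
  have fin1 : omega [set 1%g] \is a fin_num.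
    by apply: fin_num_measure; exact: measurable_set1_circle.
  move: (omegaE _ measurableT); rewrite probability_setT.
  under eq_bigr do rewrite indicT mul1e.
  rewrite -(fineK fin1) sumEFin sumr_const card_ord => -[h].
  have r_neq0 : r%:R != 0 :> R by rewrite pnatr_eq0 -lt0n.
  by congr EFin; apply: (mulIf r_neq0); rewrite mulVf // mulr_natr -h.
move=> A mA; rewrite omegaE // omega1E /uniform_grid.
by apply: eq_bigr => j _; rewrite diracE indicE muleC.
Qed.

End finite_haar.

(** * Compact subgroups of the circle and the law of e^{iU} *)

Section haar_law.
Context {R : realType}.

Lemma hausdorff_circle : hausdorff_space (circle R).
Proof.
move=> z w zw.
have eq_of (f : circle R -> R) : continuous f -> f z = f w.
  move=> cf; apply: (@Rhausdorff R) => A B zA wB.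
  have [u [Au Bu]] := zw _ _ (cf z A zA) (cf w B wB).
  by exists (f u).
have re := eq_of _ circle_Re_continuous; have im := eq_of _ circle_Im_continuous.
by apply/val_inj/eqP; rewrite eq_complex re im !eqxx.
Qed.

(** The preimage of H under [expi] is a closed subgroup of the line containing 2 pi. It is the whole
    line or c Z; in the second case 2 pi = c r for a positive integer r, and H consists of the r-th
    roots of unity. *)
Lemma compact_subgroup_circle (H : set (circle R)) : compact_subgroup H ->
  H = setT \/ exists2 r, (0 < r)%N & H = roots_of_unity r.
Proof.
move=> [cH H1 HM HV].
have clH : closed H by apply: compact_closed => //; exact: hausdorff_circle.
have twopi : expi (2 * pi) = 1%g :> circle R.
  by have := @expi_int_2pi R 1; rewrite mul1r.
have [||||LT|[c c0 LE]] := @closed_subgroup_real R (expi @^-1` H).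
- by apply: closed_comp => // x _; exact: expi_continuous.
- by rewrite /= expi0.
- by move=> x y Hx Hy; rewrite /= expiD expiN; apply: HM => //; exact: HV.
- by exists (2 * pi); rewrite ?two_pi_gt0 //= twopi.
- left; apply/seteqP; split=> // z _; rewrite -(argK z).
  by rewrite -[H _]/((expi @^-1` H) _) LT.
right; have [n _ nE] : [set c * n%:~R | n in [set: int]] (2 * pi).
  by rewrite -LE /= twopi.
have n0 : 0 < n by rewrite -(ltr0z R) -(pmulr_rgt0 _ c0) nE two_pi_gt0.
case: n n0 nE => // r r0 nE; exists r => //.
have rR0 : r%:R != 0 :> R by rewrite pnatr_eq0 -lt0n.
have cE (j : nat) : 2 * pi * j%:R / r%:R = c * j%:R.
  by rewrite -nE /=; field.
apply/seteqP; split=> [z Hz|_ [j jr <-]]; last first.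
  by rewrite cE -[H _]/((expi @^-1` H) _) LE; exists j%:Z.
have [m _ mE] : [set c * n%:~R | n in [set: int]] (arg z).
  by rewrite -LE /= argK.
have rz0 : r%:Z != 0 by rewrite eqz_nat -lt0n.
(* Since c r = 2 pi, reducing m modulo r does not change e^{i c m}. *)
have [j jE] : exists j : nat, (m %% r)%Z = j%:Z.
  by exists `|(m %% r)%Z|%N; rewrite gez0_abs // modz_ge0.
exists j; first by rewrite /= -ltz_nat -jE ltz_pmod.
rewrite cE -[RHS](argK z) -mE [in RHS](divz_eq m r) jE.
rewrite rmorphD rmorphM mulrDr mulrCA nE expiD expi_int_2pi mul1g.
by [].
Qed.

Lemma law_expi_haar (H : set (circle R)) (omega : probability (circle R) R)
    d (Omega : measurableType d) (P : probability Omega R) (U : {RV P >-> R}) :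
    compact_subgroup H -> haar H omega ->
    (H = [set: circle R] -> forall B : set R, measurable B ->
      distribution P U B = uniform_prob two_pi_gt0 B) ->
    (forall r : nat, (0 < r)%N -> H = roots_of_unity r ->
      forall B : set R, measurable B -> distribution P U B = uniform_grid r B) ->
  forall A, measurable A -> distribution P (expi \o U) A = omega A.
Proof.
move=> /compact_subgroup_circle[->|[r r0 ->]] homega hT hr A mA.
  apply: fourier_unique => // l; have [->|l0] := eqVneq l 0.
    by rewrite !cintegral_chiT0.
  by rewrite cintegral_uniform_circle ?cintegral_haar_circle //; exact: hT.
rewrite -(haar_roots_of_unity r0 homega mA) -(hr r) //.
by rewrite -[X in measurable X]setTI; exact: expi_measurable.
Qed.

End haar_law.

(** * Independence and convolution *)

Section independence.
Local Open Scope ereal_scope.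

(** Measurable rectangles are closed under intersection and generate the product sigma-algebra. *)
Lemma eq_measure_prod d1 d2 (T1 : measurableType d1) (T2 : measurableType d2)
    (R : realType) (m1 m2 : {measure set (T1 * T2) -> \bar R}) :
    m1 setT < +oo ->
    (forall A B, measurable A -> measurable B -> m1 (A `*` B) = m2 (A `*` B)) ->
  forall D, measurable D -> m1 D = m2 D.
Proof.
move=> m1fin m12 D mD.
pose rect : set (set (T1 * T2)) := [set A `*` B | A in measurable & B in measurable].
apply: (measure_unique rect (fun=> setT)) => //.
- by rewrite measurable_prod_measurableType.
- move=> _ _ [A1 mA1 [B1 mB1 <-]] [A2 mA2 [B2 mB2 <-]]; rewrite -setXI.
  exists (A1 `&` A2); first exact: measurableI.
  by exists (B1 `&` B2); first exact: measurableI.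
- by move=> _; exists setT => //; exists setT => //; rewrite setXTT.
- by rewrite bigcup_const.
- by move=> _ [A mA [B mB <-]]; exact: m12.
Qed.

Section convolution_law.
Context {R : realType}.

Lemma measurable_mulg d (T : measurableType d) (f g : T -> circle R) :
  measurable_fun setT f -> measurable_fun setT g ->
  measurable_fun setT (fun t => (f t * g t)%g).
Proof.
move=> mf mg; have mfg : measurable_fun setT (fun t => (f t, g t)).
  exact/measurable_fun_pairP.
exact: (measurableT_comp circle_mul_measurable mfg).
Qed.

Lemma eq_convolution (mu mu' nu nu' : probability (circle R) R) :
    (forall A, measurable A -> mu A = mu' A) ->
    (forall A, measurable A -> nu A = nu' A) ->
  forall A, measurable A -> convolution mu nu A = convolution mu' nu' A.
Proof.
move=> mu_eq nu_eq A mA.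
apply: (@eq_measure_prod _ _ _ _ _ (mu \x nu) (mu' \x nu')) => [|B C mB mC|].
- by rewrite (le_lt_trans (probability_le1 _ _)) ?ltry.
- apply: (etrans (product_measure1E mu nu mB mC)).
  apply: (etrans _ (esym (product_measure1E mu' nu' mB mC))).
  by congr (_ * _); [exact: mu_eq|exact: nu_eq].
- by rewrite -[X in measurable X]setTI; exact: (circle_mul_measurable measurableT).
Qed.

(** By independence, the joint law of (Z, W) agrees with the product measure on rectangles, hence on
    the set of pairs whose product lies in A. *)
Lemma law_mul_independent d (Omega : measurableType d) (P : probability Omega R)
    (Z W : {RV P >-> circle R}) :
    (forall A B, measurable A -> measurable B ->
      P (Z @^-1` A `&` W @^-1` B) = P (Z @^-1` A) * P (W @^-1` B)) ->
  forall A, measurable A -> P ((fun t => (Z t * W t)%g) @^-1` A) =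
    convolution (distribution P Z) (distribution P W) A.
Proof.
move=> indep A mA.
have mZW : measurable_fun setT (fun t => (Z t, W t)).
  by apply/measurable_fun_pairP.
pose ZW : {mfun Omega >-> (circle R * circle R)%type} :=
  HB.pack (fun t => (Z t, W t)) (isMeasurableFun.Build _ _ _ _ _ mZW).
transitivity (distribution P ZW [set p | A (p.1 * p.2)%g]); first by [].
apply: (@eq_measure_prod _ _ _ _ _ (distribution P ZW)
  (distribution P Z \x distribution P W)) => [|B C mB mC|].
- by rewrite (le_lt_trans (probability_le1 _ _)) ?ltry.
- by apply: (etrans (indep _ _ mB mC)); apply/esym; exact: product_measure1E.
- by rewrite -[X in measurable X]setTI; exact: (circle_mul_measurable measurableT).
Qed.

End convolution_law.

(** For fixed C both sides are finite measures in D: the image under (U, X) of P restricted to {Y in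
    C}, and the joint law of (U, X) scaled by P(Y in C). They agree on rectangles. *)
Lemma independent3_pair d (Omega : measurableType d) (R : realType)
    (P : probability Omega R) (U X Y : {RV P >-> R}) : independent3 U X Y ->
  forall (D : set (R * R)) (C : set R), measurable D -> measurable C ->
    P ((fun t => (U t, X t)) @^-1` D `&` Y @^-1` C) =
    P ((fun t => (U t, X t)) @^-1` D) * P (Y @^-1` C).
Proof.
move=> indep D C mD mC.
have mUX : measurable_fun setT (fun t => (U t, X t)) by apply/measurable_fun_pairP.
pose UX : {mfun Omega >-> (R * R)%type} :=
  HB.pack (fun t => (U t, X t)) (isMeasurableFun.Build _ _ _ _ _ mUX).
have mYC : measurable (Y @^-1` C) by exact: measurable_funPTI.
pose p : {nonneg R} := NngNum (fine_ge0 (measure_ge0 P (Y @^-1` C))).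
have pE : (p%:num)%:E = P (Y @^-1` C) by rewrite /= fineK ?fin_num_measure.
rewrite -pE muleC.
have := @eq_measure_prod _ _ _ _ _ (pushforward (mrestr P mYC) UX)
  (mscale p (distribution P UX)); apply=> // [|A B mA mB].
- rewrite -[ltLHS]/(P (setT `&` Y @^-1` C)) setTI.
  by rewrite (le_lt_trans (probability_le1 P mYC)) // ltry.
(* Taking the third set to be everything yields the independence of U and X. *)
- have UX_indep := indep A B setT mA mB measurableT.
  rewrite preimage_setT setIT probability_setT mule1 in UX_indep.
  rewrite -[LHS]/(P (U @^-1` A `&` X @^-1` B `&` Y @^-1` C)).
  rewrite -[RHS]/((p%:num)%:E * P (U @^-1` A `&` X @^-1` B)).
  by rewrite pE muleC indep // UX_indep.
Qed.

End independence.

Theorem theorem3p1 (R : realType) (H : set (circle R)) (a : circle R) (b : R)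
    (eta : {measure set (circle R) -> \bar R})
    (omega gamma ppi : probability (circle R) R)
    (d : measure_display) (Omega : measurableType d) (P : probability Omega R)
    (U X Y : {RV P >-> R})
    (hH : compact_subgroup H)
    (hb : 0 <= b)
    (heta : levy_measure eta)
    (homega : haar H omega)
    (hgamma : gauss_circle b gamma)
    (hppi : generalized_poisson chiT gT eta ppi)
    (hind : independent3 U X Y)
    (hUT : H = [set: circle R] -> forall B : set R, measurable B ->
      distribution P U B = uniform_prob two_pi_gt0 B)
    (hUr : forall r : nat, (0 < r)%N -> H = roots_of_unity r ->
      forall B : set R, measurable B ->
      distribution P U B = uniform_grid r B)
    (hX : forall B : set R, measurable B ->
      distribution P X B = centered_normal b B)
    (hY : generalized_poisson chiR gR (arg_image eta) (distribution P Y)) :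
  forall A : set (circle R), measurable A ->
    pushforward P (fun t => expi (U t + arg a + X t + Y t)) A =
    convolution (convolution (convolution omega \d_a) gamma) ppi A.
Proof.
pose ZU : {RV P >-> circle R} := expi \o U.
pose ZX : {RV P >-> circle R} := expi \o X.
pose ZY : {RV P >-> circle R} := expi \o Y.
(* The point a enters as a constant random variable; its events are everything or empty, so its
   independence from [ZU] is automatic. *)
pose Za : {RV P >-> circle R} := cst a.
have mZUa : measurable_fun setT (fun t => (ZU t * Za t)%g) by exact: measurable_mulg.
pose ZUa : {RV P >-> circle R} :=
  HB.pack (fun t => (ZU t * Za t)%g) (isMeasurableFun.Build _ _ _ _ _ mZUa).
have mZUaX : measurable_fun setT (fun t => (ZUa t * ZX t)%g).
  exact: measurable_mulg.
pose ZUaX : {RV P >-> circle R} :=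
  HB.pack (fun t => (ZUa t * ZX t)%g) (isMeasurableFun.Build _ _ _ _ _ mZUaX).
have law_Ua B : measurable B -> distribution P ZUa B = convolution omega \d_a B.
  move=> mB; apply: etrans (law_mul_independent (Z := ZU) (W := Za) _ mB) _.
    move=> C D mC mD; rewrite (_ : Za @^-1` D = if a \in D then setT else set0).
      case: ifP => _; first by rewrite setIT probability_setT mule1.
      by rewrite setI0 measure0 mule0.
    by apply/seteqP; split=> t /=; case: ifPn; rewrite ?inE ?notin_setE.
  apply: eq_convolution mB => [C|C mC].
    exact: law_expi_haar hH homega hUT hUr C.
  transitivity (((a \in C)%:R : R)%:E)%E; last by apply/esym; exact: diracE.
  rewrite -[LHS]/(P (Za @^-1` C)); case: (boolP (a \in C)) => [aC|aC].
    rewrite (_ : _ @^-1` _ = setT) ?probability_setT //.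
    by apply/seteqP; split=> t //= _; exact: set_mem.
  rewrite (_ : _ @^-1` _ = set0) ?measure0 //.
  by apply/seteqP; split=> t //=; rewrite notin_setE in aC.
have law_UaX B : measurable B ->
    distribution P ZUaX B = convolution (convolution omega \d_a) gamma B.
  move=> mB; apply: etrans (law_mul_independent (Z := ZUa) (W := ZX) _ mB) _.
    move=> C D mC mD.
    (* An event about e^{iU} a is an event about U alone, so independence of U and X applies. *)
    have mC' : measurable [set x : R | C (expi x * a)%g].
      rewrite -[X in measurable X]setTI.
      exact: (measurable_mulg expi_measurable (measurable_cst a) measurableT).
    have mD' : measurable (expi @^-1` D) by exact: measurable_funPTI.
    have := hind _ _ _ mC' mD' (@measurableT _ R).
    by rewrite preimage_setT setIT probability_setT mule1.
  apply: eq_convolution mB => [C|C]; first exact: law_Ua.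
  exact: law_expi_gauss hb hX hgamma C.
move=> A mA; transitivity (P ((fun t => (ZUaX t * ZY t)%g) @^-1` A)).
  rewrite /pushforward; congr (P (_ @^-1` A)); apply/funext => t.
  by rewrite !expiD argK.
apply: etrans (law_mul_independent (Z := ZUaX) (W := ZY) _ mA) _.
  move=> C D mC mD.
  (* An event about e^{iU} a e^{iX} is rewritten as an event about the pair (U, X), which is
     independent of Y. *)
  pose C' := [set p : R * R | C (expi p.1 * a * expi p.2)%g].
  have mC' : measurable C'.
    rewrite -[X in measurable X]setTI.
    apply: (@measurable_mulg _ _ _ (fun p : R * R => expi p.1 * a)%g
      (fun p => expi p.2) _ _ measurableT _ mC).
      apply: measurable_mulg; last exact: measurable_cst.
      exact: measurableT_comp expi_measurable measurable_fst.
    exact: measurableT_comp expi_measurable measurable_snd.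
  have mD' : measurable (expi @^-1` D) by exact: measurable_funPTI.
  exact: independent3_pair hind C' _ mC' mD'.
apply: eq_convolution mA => [C|C]; first exact: law_UaX.
exact: law_expi_poisson hY hppi C.
Qed.
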